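(* Let $f$ be a positive integer and for non-negative integers $n_1,\dots,n_f$ put $N_i:=n_i+n_{i+1}+\dots+n_f$ for $i=1,\dots,f$. Then for $|q|<1$, \[ \sum_{m,n,n_1,\dots,n_f\geq 0}\frac{q^{2m^2+6mn+6n^2-2m-3n+3(N_1^2+\dots+N_f^2)}(q^3;q^3)_{n_f}(1+q^{3n_f})}{(q;q)_m(q^3;q^3)_n(q^3;q^3)_{n_f-2n-m}(q^3;q^3)_{n_1}\cdots(q^3;q^3)_{n_{f-1}}(q^3;q^3)_{2n_f}} =\frac{(q^{6(f+1)};q^{6(f+1)})_\infty}{(q^3;q^3)_\infty}\Big((-q^{3f+1},-q^{3f+5};q^{6(f+1)})_\infty+(-q^{3f+2},-q^{3f+4};q^{6(f+1)})_\infty\Big). \]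
   Context: $(a;p)_n=\prod_{k=0}^{n-1}(1-ap^k)$ for a base $p$, $(a_1,\dots,a_k;p)_n=(a_1;p)_n\cdots(a_k;p)_n$, and for $|p|<1$, $(a;p)_\infty=\lim_{n\to\infty}(a;p)_n$. By convention $1/(q^3;q^3)_n=0$ for negative integers $n$, so summands with $n_f-2n-m<0$ vanish. *)

(* Defs.v *)
From mathcomp Require Import all_boot all_order all_algebra.
From mathcomp Require Import finmap complex.
From mathcomp Require Import all_classical all_reals all_analysis.
From mathcomp Require Export summability.

Set Implicit Arguments.
Unset Strict Implicit.
Unset Printing Implicit Defensive.

Import GRing.Theory Num.Theory numFieldNormedType.Exports.
Local Open Scope classical_set_scope.
Local Open Scope ring_scope.

Section QPochhammer.
Variable R : realType.
Implicit Types (a p q : R[i]).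

Definition qpoch a p (n : nat) : R[i] := \prod_(k < n) (1 - a * p ^+ k).

(* The limit exists for `|p| < 1. The topology of R[i] induced by the complex
   modulus is only available on the alias R[i]^o. *)
Definition qpoch_infty a p : R[i]^o :=
  lim ((fun n => qpoch a p n : R[i]^o) @ \oo).

(* 1 / (a; p)_n for an integer n, with value 0 for negative n. *)
Definition inv_qpoch a p (n : int) : R[i] :=
  match n with
  | Posz k => (qpoch a p k)^-1
  | Negz _ => 0
  end.

(* The entry n_i, numbered from 1, of ns = (n_1, ..., n_f). *)
Definition entry (f : nat) (ns : f.-tuple nat) (i : nat) : nat :=
  nth 0%N ns i.-1.

Definition tail_sum (f : nat) (ns : f.-tuple nat) (i : nat) : nat :=
  (\sum_(i <= j < f.+1) entry ns j)%N.

(* An integer because of the subtractions; its values are nonnegative. *)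
Definition q_exponent (f m n : nat) (ns : f.-tuple nat) : int :=
  2 * m%:Z ^+ 2 + 6 * m%:Z * n%:Z + 6 * n%:Z ^+ 2 - 2 * m%:Z - 3 * n%:Z
  + 3 * \sum_(1 <= i < f.+1) (tail_sum ns i)%:Z ^+ 2.

Definition summand (f : nat) q (t : nat * nat * f.-tuple nat) : R[i]^o :=
  let: (m, n, ns) := t in
  let nf := entry ns f in
  q ^ (q_exponent m n ns)
  * qpoch (q ^+ 3) (q ^+ 3) nf * (1 + q ^+ (3 * nf))
  / (qpoch q q m * qpoch (q ^+ 3) (q ^+ 3) n)
  * inv_qpoch (q ^+ 3) (q ^+ 3) (nf%:Z - 2 * n%:Z - m%:Z)
  / (\prod_(1 <= i < f) qpoch (q ^+ 3) (q ^+ 3) (entry ns i)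
     * qpoch (q ^+ 3) (q ^+ 3) (2 * nf)).

End QPochhammer.

(* Main.v *)
Require Import Defs.
From mathcomp Require Import all_boot all_order all_algebra.
From mathcomp Require Import finmap complex.
From mathcomp Require Import all_classical all_reals all_analysis.
From mathcomp Require Import ring lra zify.

(* Put p = q^3 and alpha_j = p^(j^2) (q^(-2j) + q^(-j)), for j in Z. By the Jacobi
   triple product the right-hand side is (p;p)_oo^(-1) sum_j p^(f j^2) alpha_j,
   which is what f steps of the Bailey chain with a = 1 and base p give, provided
     (p;p)_L (1 + p^L) / (p;p)_(2L) * sum_(m,n) q^(2m^2+6mn+6n^2-2m-3n)
           / ((q;q)_m (p;p)_n (p;p)_(L-2n-m))
       = sum_j alpha_j / ((p;p)_(L-j) (p;p)_(L+j)).
   In this finite identity, sum_j p^(j^2) z^j [2L, L-j]_p is a Rogers-Szego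
   polynomial, hence satisfies a three-term recurrence in L. On the other side
   all sums are expressed through
     cap r k = sum_(m+2n=k) q^(2m^2+6mn+6n^2) r^n / ((q;q)_m (p;p)_n),
   which satisfies a contiguous relation between r and q^2 r and another one
   between r and q^3 r; going from q^(-2) to q^4 in two ways yields a recurrence
   in k, from which the recurrences for z = q^(-1) and z = q^(-2) follow.
   Every identity is finite until L tends to infinity; the limit L -> oo is
   taken by dominated convergence, the summands being graded by N_1. *)

Set Implicit Arguments.
Unset Strict Implicit.
Unset Printing Implicit Defensive.

Import Order.TTheory GRing.Theory Num.Theory numFieldNormedType.Exports.
Import Normc.
Local Open Scope classical_set_scope.
Local Open Scope ring_scope.

(** * Recurrences for the double sum *)

(** A sequence stands for the coefficients of a power series: [delay] is multiplication by x, f_k ->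
    p^k f_k is the substitution x -> p x, and [convqf p] is division by (x;p)_oo. Since
    [delay f 0 = 0], relations between delays hold at every index without boundary cases; since
    their coefficients are functions of q^k, they can be delayed mechanically (q^k becomes q^k / q),
    after which the shifted values are mere unknowns for [field]. The double sum,
    [convqf p (cap_phi q)], belongs to no single z. The factor 1 + p^L is what separates the two
    values of z: with phi the series of [cap_phi q], it turns phi(x)/(x;p)_oo into (phi(x) + (1 - x)
    phi(p x))/(x;p)_oo, whose numerator is the sum of the series of [cap q 1], for z = q^(-1), and
    of [cap_kappa q], for z = q^(-2). Each of these satisfies [szego_rec]. Negative powers of q
    force q != 0 in all of this; the value q = 0 is computed directly at the end. *)

Definition qfact (K : fieldType) (p : K) (n : nat) : K :=
  \prod_(k < n) (1 - p * p ^+ k).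

Definition delay (K : fieldType) (f : nat -> K) (k : nat) : K :=
  if k is k'.+1 then f k' else 0.

Definition convqf (K : fieldType) (p : K) (f : nat -> K) (L : nat) : K :=
  \sum_(k < L.+1) f k / qfact p (L - k).

Section Shift.
Variable (K : fieldType).
Implicit Types (p x : K) (f g : nat -> K).

Lemma qfact0 p : qfact p 0 = 1.
Proof. by rewrite /qfact big_ord0. Qed.

Lemma qfactS p n : qfact p n.+1 = qfact p n * (1 - p ^+ n.+1).
Proof. by rewrite /qfact big_ord_recr /= -exprS. Qed.

Lemma qfact_neq0 p n : (forall k, 1 - p ^+ k.+1 != 0) -> qfact p n != 0.
Proof.
by move=> hp; apply/prodf_neq0 => i _; rewrite -exprS.
Qed.

Lemma delay_rec1 q f g (a : K -> K) : q != 0 ->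
  (forall k, f k = a (q ^+ k) * g k) ->
  forall k, delay f k = a (q ^+ k / q) * delay g k.
Proof.
move=> q0 h [|k] /=; first by rewrite mulr0.
by rewrite h exprSr mulfK.
Qed.

Lemma delay_rec2 q f g1 g2 (a1 a2 : K -> K) : q != 0 ->
  (forall k, f k = a1 (q ^+ k) * g1 k + a2 (q ^+ k) * g2 k) ->
  forall k, delay f k = a1 (q ^+ k / q) * delay g1 k + a2 (q ^+ k / q) * delay g2 k.
Proof.
move=> q0 h [|k] /=; first by rewrite !mulr0 addr0.
by rewrite h exprSr mulfK.
Qed.

Lemma delay_rec4 q f g1 g2 g3 g4 (a1 a2 a3 a4 : K -> K) : q != 0 ->
  (forall k, f k = a1 (q ^+ k) * g1 k + a2 (q ^+ k) * g2 k
                 + a3 (q ^+ k) * g3 k + a4 (q ^+ k) * g4 k) ->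
  forall k, delay f k = a1 (q ^+ k / q) * delay g1 k + a2 (q ^+ k / q) * delay g2 k
    + a3 (q ^+ k / q) * delay g3 k + a4 (q ^+ k / q) * delay g4 k.
Proof.
move=> q0 h [|k] /=; first by rewrite !mulr0 !addr0.
by rewrite h exprSr mulfK.
Qed.

Lemma eq_delay f g : f =1 g -> delay f =1 delay g.
Proof. by move=> h [|k] /=. Qed.

(* The padding [delay f 0 = 0] supplies the initial value. *)
Lemma delay_rec_eq0 f (a : nat -> K) :
  (forall k, f k + a k * delay f k = 0) -> forall k, f k = 0.
Proof.
move=> h; elim=> [|k IH]; first by have := h 0%N; rewrite /= mulr0 addr0.
by have := h k.+1; rewrite /= IH mulr0 addr0.
Qed.

Lemma convqf_delay p f L : convqf p (delay f) L = delay (convqf p f) L.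
Proof.
case: L => [|L] /=; first by rewrite /convqf big_ord_recl big_ord0 /= mul0r addr0.
by rewrite /convqf big_ord_recl /= mul0r add0r.
Qed.

Lemma convqfD p f g L :
  convqf p (fun k => f k + g k) L = convqf p f L + convqf p g L.
Proof. by rewrite /convqf -big_split /=; apply: eq_bigr => i _; rewrite mulrDl. Qed.

Lemma convqfZ p c f L : convqf p (fun k => c * f k) L = c * convqf p f L.
Proof. by rewrite /convqf mulr_sumr; apply: eq_bigr => i _; rewrite mulrA. Qed.

Lemma eq_convqf p f g L : f =1 g -> convqf p f L = convqf p g L.
Proof. by move=> h; apply: eq_bigr => i _; rewrite h. Qed.

(** With F the series of f, F(p x)/(p x;p)_oo = (1 - x) F(p x)/(x;p)_oo; the coefficients of x^L are
    compared. *)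
Lemma convqf_mulX p f L : (forall k, 1 - p ^+ k.+1 != 0) ->
  convqf p (fun k => p ^+ k * f k) L
  = delay (convqf p (fun k => p ^+ k * f k)) L + p ^+ L * convqf p f L.
Proof.
move=> hp; case: L => [|L] /=.
  by rewrite /convqf !big_ord_recl !big_ord0 /= !expr0 !mul1r !addr0 add0r.
rewrite /convqf big_ord_recr /= [X in _ = _ + p ^+ L.+1 * X]big_ord_recr /= subnn mulrDr addrA.
congr (_ + _); last by rewrite mulrA.
rewrite mulr_sumr -big_split /=; apply: eq_bigr => k _.
have hk : (k <= L)%N by rewrite -ltnS.
rewrite subSn // qfactS; set d := (L - k)%N.
have hd : qfact p d != 0 by exact: qfact_neq0.
have h1 := hp d.
have -> : p ^+ L.+1 = p ^+ k * p ^+ d.+1.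
  by rewrite -exprD; congr (_ ^+ _); rewrite /d; lia.
by field; rewrite hd h1.
Qed.

End Shift.

(* The coefficients of a power series g with g(0) = 1 and
   sum_L x^L A_L(z) / (p;p)_L = g(x) / (x;p)_oo, where
   A_L(z) = sum_j p^(j^2) z^j [2L, L-j]_p and zeta = z + 1/z. *)
Definition szego_rec (K : fieldType) (p zeta : K) (g : nat -> K) : Prop := forall k,
  let P := p ^+ k in
  (1 - P) * g k = (P + zeta * P ^+ 2 / p) * delay g k
    + (P ^+ 2 / p ^+ 2 + P ^+ 3 / p ^+ 3) * delay (delay g) k
    - P ^+ 3 / p ^+ 4 * delay (delay (delay g)) k.

Section Capparelli.
Variables (K : fieldType) (q : K).
Hypothesis q0 : q != 0.
Hypothesis q_free : forall k, 1 - q ^+ k.+1 != 0.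
Let p := q ^+ 3.

Lemma q3_free k : 1 - p ^+ k.+1 != 0.
Proof. by rewrite /p -exprM mulnS; exact: q_free. Qed.

(** The guard discards those n for which truncated subtraction would give a spurious m = 0. *)
Definition cap_term (r : K) (k n : nat) : K :=
  if (n.*2 <= k)%N then
    let m := (k - n.*2)%N in
    q ^+ (2 * m ^ 2 + 6 * m * n + 6 * n ^ 2) * r ^+ n / (qfact q m * qfact p n)
  else 0.

Definition cap (r : K) (k : nat) : K := \sum_(n < k.+1) cap_term r k n.

(** With m = k + 1 - 2n, q^(2n) = q^(k+1) + q^(2n) (1 - q^m), and 1 - q^m cancels the last factor of
    (q;q)_m. The resulting power of q depends on k only, so the relation can be summed over n. *)
Lemma cap_term_recm r k n :
  cap_term (q ^+ 2 * r) k.+1 n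
  = q ^+ k.+1 * cap_term r k.+1 n + q ^+ (4 * k + 2) * cap_term r k n.
Proof.
rewrite /cap_term.
have hq j : qfact q j != 0 by exact: qfact_neq0.
have hp j : qfact p j != 0 by apply: qfact_neq0; exact: q3_free.
have hqn := hq n; have hpn := hp n.
case: (ltngtP n.*2 k.+1) => h.
- have h' : (n.*2 <= k)%N by [].
  rewrite h' subSn //.
  set m := (k - n.*2)%N.
  have -> : (2 * m.+1 ^ 2 + 6 * m.+1 * n + 6 * n ^ 2
     = (2 * m ^ 2 + 6 * m * n + 6 * n ^ 2) + (m * 4 + 2 + n * 6))%N by nia.
  have -> : k.+1 = (m + n * 2 + 1)%N by rewrite /m; lia.
  have -> : (4 * k + 2 = m * 4 + n * 8 + 2)%N by rewrite /m; lia.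
  set e := (_ + 6 * n ^ 2)%N; rewrite qfactS.
  have -> : (q ^+ 2 * r) ^+ n = (q ^+ n) ^+ 2 * r ^+ n by rewrite exprMn -!exprM mulnC.
  rewrite !exprD !exprM expr1.
  have hm := hq m; have hm1 := q_free m; rewrite exprS in hm1 *.
  by field; rewrite hpn hm hm1.
- have -> : (n.*2 <= k)%N = false by lia.
  by rewrite !mulr0 addr0.
- have -> : (n.*2 <= k)%N = false by lia.
  rewrite mulr0 addr0 exprMn -exprM (mul2n n).
  have -> : q ^+ n.*2 = q ^+ k.+1 by rewrite h.
  by rewrite mulrCA -!mulrA.
Qed.

Lemma cap_term_gt r k n : (k < n.*2)%N -> cap_term r k n = 0.
Proof. by rewrite /cap_term ltnNge => /negbTE ->. Qed.

Lemma cap0 r : cap r 0 = 1.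
Proof.
rewrite /cap big_ord_recl big_ord0 addr0 /cap_term /= !qfact0.
by rewrite !expr0 !mulr1 divr1.
Qed.

Lemma cap_recm r k :
  cap (q ^+ 2 * r) k
  = q ^+ k * cap r k + (q ^+ k) ^+ 4 / q ^+ 2 * delay (cap r) k.
Proof.
case: k => [|k]; first by rewrite /= !cap0 !expr0; ring.
have -> : (q ^+ k.+1) ^+ 4 / q ^+ 2 = q ^+ (4 * k + 2).
  have -> : (4 * k + 2 = k * 4 + 2)%N by lia.
  by rewrite (exprS q k) exprD exprM; field.
have -> : delay (cap r) k.+1 = \sum_(n < k.+2) cap_term r k n.
  by rewrite big_ord_recr /= cap_term_gt ?addr0 //; lia.
rewrite /cap !mulr_sumr -big_split; apply: eq_bigr => n _.
exact: cap_term_recm.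
Qed.

(** The factor 1 - p^(n+1) cancels the last one of (p;p)_(n+1), which lowers n by 1 and k by 2; the
    quadratic exponent drops by 6m + 12n + 6 = 6k + 6, again a function of k. *)
Lemma cap_term_recn r k n :
  (1 - p ^+ n.+1) * cap_term r k.+2 n.+1 = r * q ^+ (6 * k + 6) * cap_term r k n.
Proof.
rewrite /cap_term doubleS !ltnS.
have hq j : qfact q j != 0 by exact: qfact_neq0.
have hp j : qfact p j != 0 by apply: qfact_neq0; exact: q3_free.
case: leqP => h; last by rewrite !mulr0.
rewrite !subSS; set m := (k - n.*2)%N.
have -> : (2 * m ^ 2 + 6 * m * n.+1 + 6 * n.+1 ^ 2
     = (2 * m ^ 2 + 6 * m * n + 6 * n ^ 2) + (6 * k + 6))%N by rewrite /m; nia.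
rewrite exprD (exprS r n) qfactS.
by have := q3_free n; have := hp n; have := hq m => *; field; apply/and3P; split.
Qed.

Lemma cap_term_scale r c k n : cap_term (c * r) k n = c ^+ n * cap_term r k n.
Proof.
rewrite /cap_term; case: ifP => _; last by rewrite mulr0.
by rewrite exprMn !mulrA (mulrC _ (c ^+ n)).
Qed.

Lemma cap_recn r k :
  cap (q ^+ 3 * r) k
  = cap r k - r * (q ^+ k) ^+ 6 / q ^+ 6 * delay (delay (cap r)) k.
Proof.
suff <- : cap r k - cap (q ^+ 3 * r) k
    = r * (q ^+ k) ^+ 6 / q ^+ 6 * delay (delay (cap r)) k by rewrite subKr.
rewrite /cap -sumrB.
have -> : \sum_(i < k.+1) (cap_term r k i - cap_term (q ^+ 3 * r) k i)
   = \sum_(i < k.+1) (1 - p ^+ i) * cap_term r k i.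
  by apply: eq_bigr => i _; rewrite cap_term_scale mulrBl mul1r.
rewrite big_ord_recl /= expr0 subrr mul0r add0r.
case: k => [|[|k]] /=; first by rewrite big_ord0 mulr0.
  by rewrite big_ord_recl big_ord0 /= cap_term_gt ?mulr0 ?addr0.
have -> : \sum_(n < k.+1) cap_term r k n = \sum_(n < k.+2) cap_term r k n.
  by rewrite [RHS]big_ord_recr /= cap_term_gt ?addr0 //; lia.
rewrite mulr_sumr.
apply: eq_bigr => i _; rewrite cap_term_recn; congr (_ * _).
have -> : (6 * k + 6 = k * 6 + 6)%N by lia.
by rewrite (exprS q k.+1) (exprS q k) exprD exprM; field.
Qed.

Let Y := cap (q ^- 2).

Definition cap_rec (k : nat) : K :=
  let x := q ^+ k in
  (1 - x ^+ 3) * Y k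
  + - (x ^+ 3 / q + x ^+ 6 / q ^+ 2 + x ^+ 6 / q ^+ 3) * delay Y k
  + - ((x ^+ 6 + x ^+ 9) / q ^+ 8) * delay (delay Y) k
  + x ^+ 9 / q ^+ 15 * delay (delay (delay Y)) k.

Lemma delay_cap_rec k :
  let x := q ^+ k / q in
  delay cap_rec k = (1 - x ^+ 3) * delay Y k
  + - (x ^+ 3 / q + x ^+ 6 / q ^+ 2 + x ^+ 6 / q ^+ 3) * delay (delay Y) k
  + - ((x ^+ 6 + x ^+ 9) / q ^+ 8) * delay (delay (delay Y)) k
  + x ^+ 9 / q ^+ 15 * delay (delay (delay (delay Y))) k.
Proof.
exact: (delay_rec4 q0 (f := cap_rec) (a1 := fun x => 1 - x ^+ 3)
  (a2 := fun x => - (x ^+ 3 / q + x ^+ 6 / q ^+ 2 + x ^+ 6 / q ^+ 3))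
  (a3 := fun x => - ((x ^+ 6 + x ^+ 9) / q ^+ 8))
  (a4 := fun x => x ^+ 9 / q ^+ 15) (fun k => erefl)).
Qed.

Lemma cap1E k :
  cap 1 k = q ^+ k * Y k + (q ^+ k) ^+ 4 / q ^+ 2 * delay Y k.
Proof. by rewrite /Y -cap_recm mulfV ?expf_neq0. Qed.

Lemma capqE k :
  cap q k = 1 * Y k + - ((q ^+ k) ^+ 6 / q ^+ 8) * delay (delay Y) k.
Proof.
have e : q ^+ 3 * q ^- 2 = q by field.
by rewrite -[X in cap X k]e cap_recn -/Y; field.
Qed.

(* Both ways of climbing from q^-2 to q^4, by three steps of cap_recm or two
   steps of cap_recn, are compared. *)
Lemma cap_rec_eq0 k : cap_rec k = 0.
Proof.
(* The comparison has order 4 and factors: it says that [cap_rec k] plus x^3 / q times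
   [delay cap_rec k] vanishes, where x = q^k. *)
apply: (@delay_rec_eq0 _ _ (fun k => (q ^+ k) ^+ 3 / q)) => {}k.
have c2 j : cap (q ^+ 2) j = q ^+ j * cap 1 j + (q ^+ j) ^+ 4 / q ^+ 2 * delay (cap 1) j.
  by rewrite -cap_recm mulr1.
have c4 : cap (q ^+ 4) k = q ^+ k * cap (q ^+ 2) k
     + (q ^+ k) ^+ 4 / q ^+ 2 * delay (cap (q ^+ 2)) k.
  by rewrite -cap_recm -exprD.
have c4' : cap (q ^+ 4) k = cap q k - q * (q ^+ k) ^+ 6 / q ^+ 6 * delay (delay (cap q)) k.
  by rewrite -cap_recn -exprSr.
have s1 := delay_rec2 q0 (a1 := fun x => x) (a2 := fun x => x ^+ 4 / q ^+ 2) cap1E.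
have s2 := delay_rec2 q0 (a1 := fun x => x) (a2 := fun x => x ^+ 4 / q ^+ 2) c2.
have ss1 := delay_rec2 q0 (a1 := fun x => x / q) (a2 := fun x => (x / q) ^+ 4 / q ^+ 2) s1.
have sq := delay_rec2 q0 (a1 := fun x => 1) (a2 := fun x => - (x ^+ 6 / q ^+ 8)) capqE.
have ssq := delay_rec2 q0 (a1 := fun x => 1) (a2 := fun x => - ((x / q) ^+ 6 / q ^+ 8)) sq.
move: c4; rewrite {}c4' delay_cap_rec s2 c2 ss1 s1 cap1E ssq capqE /cap_rec.
set x := q ^+ k.
move: (Y k) (delay Y k) (delay (delay Y) k) (delay (delay (delay Y)) k)
  (delay (delay (delay (delay Y))) k) => y0 y1 y2 y3 y4 /eqP.
rewrite -subr_eq0 => /eqP h; rewrite -[RHS]h; field.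
exact: q0.
Qed.

(** With k = m + 2n, the choice r = q and the factor q^(-2k) restore the linear exponent: q^n
    q^(-2k) = q^(-2m-3n). *)
Definition cap_phi (k : nat) : K := (q ^+ k) ^- 2 * cap q k.

(** What remains in [cap_phiE] once [cap 1] is split off; by [cap1E] the two differ only in the
    power of q dividing the delayed term. *)
Definition cap_kappa (k : nat) : K :=
  q ^+ k * Y k + (q ^+ k) ^+ 4 / q ^+ 3 * delay Y k.

Lemma cap_phiE k :
  (1 + p ^+ k) * cap_phi k - p ^+ k / p * delay cap_phi k = cap 1 k + cap_kappa k.
Proof.
have sphi := delay_rec1 q0 (a := fun x => x ^- 2) (fun k => erefl (cap_phi k)).
have sq := delay_rec2 q0 (a1 := fun x => 1) (a2 := fun x => - (x ^+ 6 / q ^+ 8)) capqE.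
have := cap_rec_eq0 k; rewrite sphi sq /cap_phi capqE cap1E /cap_kappa /cap_rec.
have -> : p ^+ k = (q ^+ k) ^+ 3 by rewrite /p -!exprM mulnC.
have x0 : q ^+ k != 0 by rewrite expf_neq0.
rewrite /p; set x := q ^+ k in x0 *.
(* The two sides differ by x^(-2) times [cap_rec k]. *)
move: (Y k) (delay Y k) (delay (delay Y) k) (delay (delay (delay Y)) k)
  => y0 y1 y2 y3 h.
apply/eqP; rewrite -subr_eq0 -(mulr0 (x ^- 2)) -h; apply/eqP; field.
by rewrite x0 q0.
Qed.

Lemma cap1_szego : szego_rec p (q + q^-1) (cap 1).
Proof.
move=> k /=.
have s1 := delay_rec2 q0 (a1 := fun x => x) (a2 := fun x => x ^+ 4 / q ^+ 2) cap1E.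
have s2 := delay_rec2 q0 (a1 := fun x => x / q) (a2 := fun x => (x / q) ^+ 4 / q ^+ 2) s1.
have s3 := delay_rec2 q0 (a1 := fun x => x / q / q) (a2 := fun x => (x / q / q) ^+ 4 / q ^+ 2) s2.
have := delay_cap_rec k; rewrite (eq_delay cap_rec_eq0) s3 s2 s1 cap1E.
have -> : delay (fun=> 0) k = 0 :> K by case: (k).
have := cap_rec_eq0 k; rewrite /cap_rec.
have -> : p ^+ k = (q ^+ k) ^+ 3 by rewrite /p -!exprM mulnC.
rewrite /p; set x := q ^+ k.
move: (Y k) (delay Y k) (delay (delay Y) k) (delay (delay (delay Y)) k)
  (delay (delay (delay (delay Y))) k) => y0 y1 y2 y3 y4 h h'.
(* The multipliers x and x^4 / q^2 are the coefficients of [cap1E]: [cap_rec] goes through the same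
   combination that turns [Y] into [cap 1]. *)
apply/eqP; rewrite -subr_eq0 -(addr0 0) -{1}(mulr0 x) -{1}h.
rewrite -(mulr0 (x ^+ 4 / q ^+ 2)) h'; apply/eqP; field.
exact: q0.
Qed.

Lemma cap_kappa_szego : szego_rec p (q ^+ 2 + q ^- 2) cap_kappa.
Proof.
move=> k /=.
have s1 := delay_rec2 q0 (a1 := fun x => x) (a2 := fun x => x ^+ 4 / q ^+ 3)
  (fun k => erefl (cap_kappa k)).
have s2 := delay_rec2 q0 (a1 := fun x => x / q) (a2 := fun x => (x / q) ^+ 4 / q ^+ 3) s1.
have s3 := delay_rec2 q0 (a1 := fun x => x / q / q) (a2 := fun x => (x / q / q) ^+ 4 / q ^+ 3) s2.
have := delay_cap_rec k; rewrite (eq_delay cap_rec_eq0) s3 s2 s1 /cap_kappa.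
have -> : delay (fun=> 0) k = 0 :> K by case: (k).
have := cap_rec_eq0 k; rewrite /cap_rec.
have -> : p ^+ k = (q ^+ k) ^+ 3 by rewrite /p -!exprM mulnC.
rewrite /p; set x := q ^+ k.
move: (Y k) (delay Y k) (delay (delay Y) k) (delay (delay (delay Y)) k)
  (delay (delay (delay (delay Y))) k) => y0 y1 y2 y3 y4 h h'.
apply/eqP; rewrite -subr_eq0 -(addr0 0) -{1}(mulr0 x) -{1}h.
rewrite -(mulr0 (x ^+ 4 / q ^+ 3)) h'; apply/eqP; field.
exact: q0.
Qed.

End Capparelli.

(** * Rogers-Szego polynomials and their recurrences *)

Section Szego.
Variables (K : fieldType) (p : K).
Hypothesis p0 : p != 0.
Hypothesis p_free : forall k, 1 - p ^+ k.+1 != 0.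

(* The Rogers-Szego polynomial H_n(z; 1/p), divided by (p;p)_n. *)
Definition szego (z : K) (n : nat) : K :=
  \sum_(a < n.+1) z ^+ a / (p ^+ (a * (n - a)) * qfact p a * qfact p (n - a)).

Let qf_neq0 n : qfact p n != 0.
Proof. exact: qfact_neq0. Qed.

Lemma szego0 z : szego z 0 = 1.
Proof.
by rewrite /szego big_ord_recl big_ord0 /= !qfact0 !expr0 !mulr1 divr1 addr0.
Qed.

(** Here 1/p^(n-a) = 1 + (1 - p^(n-a))/p^(n-a), and 1 - p^(n-a) cancels the last factor of
    (p;p)_(n-a). *)
Lemma szego_weighted (z : K) n :
  \sum_(a < n.+1)
    z ^+ a / (p ^+ (a * (n - a)) * qfact p a * qfact p (n - a)) / p ^+ (n - a)
  = szego z n + delay (szego z) n / p ^+ n.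
Proof.
case: n => [|n] /=.
  by rewrite /szego !big_ord_recl !big_ord0 /= expr0 divr1 mul0r !addr0.
apply/eqP; rewrite addrC -subr_eq {2}/szego -sumrB; apply/eqP.
rewrite big_ord_recr /= subnn expr0 divr1 subrr addr0 /szego mulr_suml.
apply: eq_bigr => a _; have ha : (a <= n)%N by rewrite -ltnS.
rewrite subSn //; set d := (n - a)%N; rewrite qfactS.
have -> : p ^+ n.+1 = p ^+ a * p ^+ d.+1.
  by rewrite -exprD; congr (_ ^+ _); rewrite /d; lia.
rewrite mulnS exprD.
have h1 := qf_neq0 a; have h2 := qf_neq0 d; have h3 := p_free d.
have h4 : p ^+ (a * d) != 0 by rewrite expf_neq0.
have h5 : p ^+ a != 0 by rewrite expf_neq0.
have h6 : p ^+ d.+1 != 0 by rewrite expf_neq0.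
by field; rewrite h1 h2 h3 h4 h5 h6.
Qed.

(** In base 1/p this is the classical H_(n+1) = (1 + z) H_n - z (1 - p^(-n)) H_(n-1). It rests on 1
    - p^(n+1) = (1 - p^a) + p^a (1 - p^(n+1-a)), where each bracket cancels the last factor of a
    q-factorial. *)
Lemma szegoS (z : K) n :
  (1 - p ^+ n.+1) * szego z n.+1
  = (1 + z) * szego z n + z / p ^+ n * delay (szego z) n.
Proof.
have -> : (1 + z) * szego z n + z / p ^+ n * delay (szego z) n
    = z * (szego z n + delay (szego z) n / p ^+ n) + szego z n by ring.
rewrite -szego_weighted [X in _ = X + _]mulr_sumr.
pose t a := z ^+ a / (p ^+ (a * (n.+1 - a)) * qfact p a * qfact p (n.+1 - a)).
have -> : (1 - p ^+ n.+1) * szego z n.+1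
   = \sum_(a < n.+2) (1 - p ^+ a) * t a
     + \sum_(a < n.+2) (p ^+ a * (1 - p ^+ (n.+1 - a))) * t a.
  rewrite -big_split /szego mulr_sumr; apply: eq_bigr => a _ /=.
  rewrite -/(t a) -mulrDl; congr (_ * _).
  have -> : p ^+ n.+1 = p ^+ a * p ^+ (n.+1 - a).
    by rewrite -exprD subnKC // -ltnS.
  by ring.
congr (_ + _).
  rewrite big_ord_recl /= expr0 subrr mul0r add0r; apply: eq_bigr => a _.
  have ha : (a <= n)%N by rewrite -ltnS.
  rewrite /t /= /bump /= add1n subSS; set d := (n - a)%N.
  rewrite qfactS mulSn exprD (exprS z).
  have h1 := qf_neq0 a; have h2 := qf_neq0 d; have h3 := p_free a.
  have h4 : p ^+ (a * d) != 0 by rewrite expf_neq0.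
  have h5 : p ^+ d != 0 by rewrite expf_neq0.
  by field; rewrite h1 h2 h3 h4 h5.
rewrite big_ord_recr /= subnn expr0 subrr mulr0 mul0r addr0; apply: eq_bigr => a _.
have ha : (a <= n)%N by rewrite -ltnS.
rewrite /t subSn //; set d := (n - a)%N.
rewrite qfactS mulnS exprD.
have h1 := qf_neq0 a; have h2 := qf_neq0 d; have h3 := p_free d.
have h4 : p ^+ (a * d) != 0 by rewrite expf_neq0.
have h5 : p ^+ a != 0 by rewrite expf_neq0.
by field; rewrite h1 h2 h3 h4 h5.
Qed.

(** Only even degrees occur in A_L(z), so the odd ones are eliminated between three instances of
    [szegoS]. *)
Lemma szego_rec2 (z : K) n :
  (1 - p ^+ n.+3) * (1 - p ^+ n.+4) * szego z n.+4
  = ((1 + z) ^+ 2 + (1 - p ^+ n.+3) * z / p ^+ n.+3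
      + (1 - p ^+ n.+2) * z / p ^+ n.+2) * szego z n.+2
    - z ^+ 2 / (p ^+ n.+2 * p ^+ n.+1) * szego z n.
Proof.
have h4 := szegoS z n.+3; have h3 := szegoS z n.+2; have h2 := szegoS z n.+1.
rewrite /= in h2 h3 h4.
rewrite -mulrA h4.
have -> : (1 - p ^+ n.+3) * ((1 + z) * szego z n.+3 + z / p ^+ n.+3 * szego z n.+2)
  = (1 + z) * ((1 - p ^+ n.+3) * szego z n.+3)
    + (1 - p ^+ n.+3) * z / p ^+ n.+3 * szego z n.+2 by ring.
rewrite h3.
have -> : (1 + z) * ((1 + z) * szego z n.+2 + z / p ^+ n.+2 * szego z n.+1)
  = (1 + z) ^+ 2 * szego z n.+2 + z / p ^+ n.+2 * ((1 + z) * szego z n.+1) by ring.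
have -> : (1 + z) * szego z n.+1
  = (1 - p ^+ n.+2) * szego z n.+2 - z / p ^+ n.+1 * szego z n by rewrite h2; ring.
have k1 : p ^+ n.+1 != 0 by rewrite expf_neq0.
have k2 : p ^+ n.+2 != 0 by rewrite expf_neq0.
have k3 : p ^+ n.+3 != 0 by rewrite expf_neq0.
by field; rewrite k1 k2 k3.
Qed.

(** For a = L + j one has a (2L - a) = L^2 - j^2, so the prefactor centres the sum at j = 0: this is
    A_L(z) / (p;p)_(2L). *)
Definition szego_central (z : K) (L : nat) : K :=
  p ^+ (L ^ 2) / z ^+ L * szego z L.*2.

(** The normalisation b L = A_L(z) / (p;p)_L is the one whose recurrence coincides with that of
    [convqf_rec]. *)
Lemma szego_central_rec (z : K) L : z != 0 ->
  let b L := qfact p L.*2 / qfact p L * szego_central z L in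
  let X := p ^+ L.+2 in
  (1 - X) * b L.+2 = (1 + p + (z + z^-1) * X ^+ 2 / p) * b L.+1
     - p * (1 + X / p) * (1 - X ^+ 2 / p ^+ 3) * b L.
Proof.
move=> z0 b X; rewrite /b /szego_central !doubleS.
have h := szego_rec2 z L.*2; set n := L.*2 in h *.
have h1 := qf_neq0 L; have h2 := p_free L; have h3 := p_free L.+1.
have h4 := qf_neq0 n; have k1 := p_free n; have k2 := p_free n.+1.
have k3 := p_free n.+2; have k4 := p_free n.+3.
have zL : z ^+ L != 0 by rewrite expf_neq0.
have u0 : p ^+ L != 0 by rewrite expf_neq0.
have -> : szego z n.+4 = ((1 - p ^+ n.+3) * (1 - p ^+ n.+4) * szego z n.+4)
   / ((1 - p ^+ n.+3) * (1 - p ^+ n.+4)) by field; rewrite k3 k4.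
rewrite {}h.
have -> : p ^+ (L.+2 ^ 2) = p ^+ (L ^ 2) * (p ^+ L) ^+ 4 * p ^+ 4.
  by rewrite -!exprM -!exprD; congr (_ ^+ _); clear; nia.
have -> : p ^+ (L.+1 ^ 2) = p ^+ (L ^ 2) * (p ^+ L) ^+ 2 * p.
  by rewrite -!exprM -exprD -exprSr; congr (_ ^+ _); clear; nia.
rewrite !qfactS /X.
have pS j : p ^+ (L + j) = p ^+ L * p ^+ j by rewrite exprD.
have pn j : p ^+ (n + j) = (p ^+ L) ^+ 2 * p ^+ j by rewrite exprD /n -muln2 exprM.
have := pS 1%N; have := pS 2%N; have := pn 1%N; have := pn 2%N; have := pn 3%N.
have := pn 4%N; have := pn 0%N; rewrite !addnS !addn0 => n0 n4 n3 n2 n1 s2 s1.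
rewrite ?(n1, n2, n3, n4, n0) ?(s1, s2) in h2 h3 k1 k2 k3 k4 *.
rewrite !(exprS z L.+1) !(exprS z L).
move: (szego z n) (szego z n.+2) (qfact p n) (qfact p L) (p ^+ (L ^ 2)) (z ^+ L)
  (p ^+ L) h1 h2 h3 h4 k1 k2 k3 k4 zL u0
  => y0 y2 f2 f1 pp zz u h1 h2 h3 h4 k1 k2 k3 k4 zL u0.
by field; rewrite ?h1 ?h2 ?h3 ?h4 ?k1 ?k2 ?k3 ?k4 ?zL ?u0 ?z0 ?p0.
Qed.

(* Multiplication of the coefficients by p^k becomes, after division by (x;p)_oo,
   a first-order difference. With [th] the image of the recurrence, the
   combination th - (1 + p) delay th + p delay^2 th (multiplication by
   (1 - x)(1 - p x)) eliminates the weighted sums C1, C2, C3. *)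
Lemma convqf_rec (zeta : K) (g : nat -> K) : szego_rec p zeta g -> forall L,
  let X := p ^+ L in
  (1 - X) * convqf p g L = (1 + p + zeta * X ^+ 2 / p) * delay (convqf p g) L
     - p * (1 + X / p) * (1 - X ^+ 2 / p ^+ 3) * delay (delay (convqf p g)) L.
Proof.
move=> hg.
pose w (f : nat -> K) k := p ^+ k * f k.
pose C0 := convqf p g; pose C1 := convqf p (w g).
pose C2 := convqf p (w (w g)); pose C3 := convqf p (w (w (w g))).
have x0 L : p ^+ L != 0 by rewrite expf_neq0.
have hw (f : nat -> K) L : convqf p (w f) L
    = delay (convqf p (w f)) L + p ^+ L * convqf p f L by exact: convqf_mulX.
have e1 L : C0 L = (p ^+ L)^-1 * C1 L + - (p ^+ L)^-1 * delay C1 L.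
  by have := x0 L; rewrite {1}/C1 hw -/C1 -/C0 => h; field.
have e2 L : C1 L = (p ^+ L)^-1 * C2 L + - (p ^+ L)^-1 * delay C2 L.
  by have := x0 L; rewrite {1}/C2 hw -/C2 -/C1 => h; field.
have e3 L : C2 L = (p ^+ L)^-1 * C3 L + - (p ^+ L)^-1 * delay C3 L.
  by have := x0 L; rewrite {1}/C3 hw -/C3 -/C2 => h; field.
have sw (f : nat -> K) k : p ^+ k * delay f k = p * delay (w f) k.
  by case: k => [|k] /=; rewrite ?mulr0 // exprS /w mulrA.
have theta L : C0 L = C1 L + p * delay C1 L + zeta * p * delay C2 L
    + p ^+ 2 * delay (delay C2) L + p ^+ 3 * delay (delay C3) L
    - p ^+ 5 * delay (delay (delay C3)) L.
  have sC (f : nat -> K) k : delay (convqf p f) k = convqf p (delay f) k.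
    by rewrite convqf_delay.
  have ssC (f : nat -> K) k : delay (delay (convqf p f)) k = convqf p (delay (delay f)) k.
    by rewrite convqf_delay; apply: eq_delay => j; rewrite convqf_delay.
  have sssC (f : nat -> K) k :
      delay (delay (delay (convqf p f))) k = convqf p (delay (delay (delay f))) k.
    by rewrite convqf_delay; apply: eq_delay => j; rewrite ssC.
  rewrite /C1 /C2 /C3 !sssC !ssC !sC -!mulNr -!convqfZ -!convqfD; apply: eq_convqf => k.
  have w1 (f : nat -> K) : delay (w f) k = p ^+ k / p * delay f k.
    by have := sw f k => h; apply: (mulfI p0); rewrite -h; field.
  have ws (f : nat -> K) : delay (delay (w f)) k = p ^+ k / p ^+ 2 * delay (delay f) k.
    case: k {w1} => [|[|k]] /=; rewrite ?mulr0 //.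
    by rewrite /w (exprS p k.+1) (exprS p k); field.
  have wss (f : nat -> K) : delay (delay (delay (w f))) k
       = p ^+ k / p ^+ 3 * delay (delay (delay f)) k.
    case: k {w1 ws} => [|[|[|k]]] /=; rewrite ?mulr0 //.
    by rewrite /w (exprS p k.+2) (exprS p k.+1) (exprS p k); field.
  rewrite !w1 !ws !wss /w; apply/eqP; rewrite -subr_eq0; apply/eqP.
  have := hg k => /= /eqP; rewrite -subr_eq0 => /eqP h; rewrite -[RHS]h; field.
  exact: p0.
have s1 := delay_rec2 p0 (a1 := fun x => x^-1) (a2 := fun x => - x^-1) e1.
have s2 := delay_rec2 p0 (a1 := fun x => x^-1) (a2 := fun x => - x^-1) e2.
have s3 := delay_rec2 p0 (a1 := fun x => x^-1) (a2 := fun x => - x^-1) e3.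
have t1 := delay_rec2 p0 (a1 := fun x => (x / p)^-1) (a2 := fun x => - (x / p)^-1) s1.
have t2 := delay_rec2 p0 (a1 := fun x => (x / p)^-1) (a2 := fun x => - (x / p)^-1) s2.
have t3 := delay_rec2 p0 (a1 := fun x => (x / p)^-1) (a2 := fun x => - (x / p)^-1) s3.
have r2 := delay_rec2 p0 (a1 := fun x => (x / p / p)^-1) (a2 := fun x => - (x / p / p)^-1) t2.
have r3 := delay_rec2 p0 (a1 := fun x => (x / p / p)^-1) (a2 := fun x => - (x / p / p)^-1) t3.
have o3 := delay_rec2 p0 (a1 := fun x => (x / p / p / p)^-1) (a2 := fun x => - (x / p / p / p)^-1) r3.
pose th L := C0 L - (C1 L + p * delay C1 L + zeta * p * delay C2 L
    + p ^+ 2 * delay (delay C2) L + p ^+ 3 * delay (delay C3) L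
    - p ^+ 5 * delay (delay (delay C3)) L).
have th0 L : th L = 0 by rewrite /th theta subrr.
move=> L X.
have sth j : delay th j = delay C0 j - (delay C1 j + p * delay (delay C1) j
    + zeta * p * delay (delay C2) j + p ^+ 2 * delay (delay (delay C2)) j
    + p ^+ 3 * delay (delay (delay C3)) j
    - p ^+ 5 * delay (delay (delay (delay C3))) j).
  by case: j => [|j] //=; rewrite !mulr0; ring.
have h0 := th0 L.
have h1 : delay th L = 0 by rewrite (eq_delay th0); case: (L).
have h2 : delay (delay th) L = 0.
  by rewrite (eq_delay (eq_delay th0)); case: (L) => [|[]].
have ssth : delay (delay th) L = delay (delay C0) L - (delay (delay C1) L
    + p * delay (delay (delay C1)) L
    + zeta * p * delay (delay (delay C2)) L
    + p ^+ 2 * delay (delay (delay (delay C2))) L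
    + p ^+ 3 * delay (delay (delay (delay C3))) L
    - p ^+ 5 * delay (delay (delay (delay (delay C3)))) L).
  by rewrite (eq_delay sth); case: (L) => [|j] //=; rewrite !mulr0; ring.
rewrite -/C0; apply/eqP; rewrite -subr_eq0; apply/eqP.
have -> : 0 = th L - (1 + p) * delay th L + p * delay (delay th) L.
  by rewrite h0 h1 h2; ring.
rewrite ssth sth /th {th th0 sth h0 h1 h2 ssth theta}.
have X0 := x0 L; rewrite /X.
rewrite t1 s1 e1 r2 t2 s2 e2 o3 r3 t3 s3 e3.
by field; rewrite X0 p0.
Qed.

End Szego.

(** The terms of index j and -j of a bilateral sum, folded together, with j = 0 counted once. *)
Definition sym_pow (K : fieldType) (z : K) (j : nat) : K :=
  if j is 0 then 1 else z ^+ j + z ^- j.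

Lemma sum_fold (K : fieldType) (f : nat -> K) (L : nat) :
  \sum_(a < L.*2.+1) f a
  = f L + \sum_(j < L) (f (L + j.+1)%N + f (L - j.+1)%N).
Proof.
elim: L f => [|L IH] f; first by rewrite big_ord_recl !big_ord0.
rewrite doubleS big_ord_recl big_ord_recr /= (IH (fun a => f a.+1)) /=.
rewrite big_ord_recr /= subnn addnn doubleS.
have -> : \sum_(i < L) (f (L.+1 + i.+1)%N + f (L.+1 - i.+1)%N)
   = \sum_(j < L) (f (L + j.+1).+1 + f (L - j.+1).+1).
  by apply: eq_bigr => i _; rewrite addSn subSn // ltn_ord.
by ring.
Qed.

Lemma sum_triangle (K : fieldType) (F : nat -> nat -> K) (L : nat) :
  \sum_(r < L.+1) \sum_(j < r.+1) F r j
  = \sum_(j < L.+1) \sum_(s < (L - j).+1) F (j + s)%N j.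
Proof.
elim: L => [|L IH].
  by rewrite !big_ord1.
rewrite big_ord_recr IH /= [RHS]big_ord_recr /= subnn.
have -> : \sum_(i < L.+1) \sum_(s < (L.+1 - i).+1) F (i + s)%N i
   = \sum_(j < L.+1) (\sum_(s < (L - j).+1) F (j + s)%N j + F L.+1 j).
  apply: eq_bigr => i _; rewrite subSn; last by rewrite -ltnS.
  by rewrite big_ord_recr /= addnS subnKC // -ltnS.
rewrite big_split /= -addrA; congr (_ + _).
by rewrite big_ord_recr /= big_ord1 addn0.
Qed.

(** * The Bailey lemma and the comparison of recurrences *)

Section QSeries.
Variables (K : fieldType) (p : K).
Hypothesis p_free : forall k, 1 - p ^+ k.+1 != 0.

Let qf_neq0 n : qfact p n != 0.
Proof. exact: qfact_neq0. Qed.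

(** This is the q-Chu-Vandermonde sum with one upper parameter sent to infinity. Induction on M, for
    all b at once: 1 - p^(M+1) = (1 - p^(M+1-s)) + p^(M+1-s) (1 - p^s), and the second part shifts
    s, which raises b by one. *)
Lemma qchu_vandermonde (M b : nat) :
  \sum_(s < M.+1) p ^+ (s * (s + b)) / (qfact p (M - s) * qfact p s * qfact p (s + b))
  = (qfact p M * qfact p (M + b))^-1.
Proof.
elim: M b => [|M IH] b.
  by rewrite big_ord_recl big_ord0 addr0 /= !qfact0 expr0 !mul1r.
pose t s := p ^+ (s * (s + b)) / (qfact p (M.+1 - s) * qfact p s * qfact p (s + b)).
have k := p_free M; apply: (mulfI k); rewrite mulr_sumr.
have -> : \sum_(s < M.+2) (1 - p ^+ M.+1) * t s
  = \sum_(s < M.+2) (1 - p ^+ (M.+1 - s)) * t s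
    + \sum_(s < M.+2) (p ^+ (M.+1 - s) * (1 - p ^+ s)) * t s.
  rewrite -big_split; apply: eq_bigr => s _ /=; rewrite -mulrDl; congr (_ * _).
  have -> : p ^+ M.+1 = p ^+ (M.+1 - s) * p ^+ s.
    by rewrite -exprD subnK // -ltnS.
  by ring.
have -> : \sum_(s < M.+2) (1 - p ^+ (M.+1 - s)) * t s = (qfact p M * qfact p (M + b))^-1.
  rewrite -IH big_ord_recr /= subnn expr0 subrr mul0r addr0; apply: eq_bigr => s _.
  rewrite /t subSn; last by rewrite -ltnS.
  set d := (M - s)%N; rewrite qfactS.
  have h1 := qf_neq0 d; have h2 := qf_neq0 s; have h3 := qf_neq0 (s + b).
  by have h4 := p_free d; field; rewrite h1 h2 h3 h4.
have -> : \sum_(s < M.+2) (p ^+ (M.+1 - s) * (1 - p ^+ s)) * t s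
   = p ^+ (M + b).+1 * (qfact p M * qfact p (M + b.+1))^-1.
  rewrite -IH big_ord_recl /= expr0 subrr mulr0 mul0r add0r mulr_sumr.
  apply: eq_bigr => s _; rewrite /t /= /bump /= add1n subSS addSnnS.
  have hs : (s <= M)%N by rewrite -ltnS.
  set d := (M - s)%N; rewrite qfactS.
  have -> : p ^+ (s.+1 * (s + b.+1)) = p ^+ (s * (s + b.+1)) * p ^+ (s + b).+1.
    by rewrite -exprD; congr (_ ^+ _); rewrite mulSn addnC addnS.
  have -> : p ^+ (M + b).+1 = p ^+ d * p ^+ (s + b).+1.
    by rewrite -exprD; congr (_ ^+ _); rewrite /d; lia.
  have h1 := qf_neq0 d; have h2 := qf_neq0 s; have h3 := qf_neq0 (s + b.+1).
  by have h4 := p_free s; field; rewrite h1 h2 h3 h4.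
rewrite addnS addSn !qfactS.
have h1 := qf_neq0 M; have h2 := qf_neq0 (M + b); have h3 := p_free (M + b).
by field; rewrite h1 h2 h3 k.
Qed.

(** The Bailey lemma with a = 1 and both parameters sent to infinity. After exchanging the sums and
    putting r = j + s, the inner sum is [qchu_vandermonde] with M = L - j and b = 2j. *)
Lemma bailey_step (al be : nat -> K) :
  (forall L, be L = \sum_(j < L.+1) al j / (qfact p (L - j) * qfact p (L + j))) ->
  forall L, \sum_(r < L.+1) p ^+ (r ^ 2) * be r / qfact p (L - r)
    = \sum_(j < L.+1) p ^+ (j ^ 2) * al j / (qfact p (L - j) * qfact p (L + j)).
Proof.
move=> hb L.
pose F r j := p ^+ (r ^ 2) * al j / (qfact p (r - j) * qfact p (r + j) * qfact p (L - r)).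
have -> : \sum_(r < L.+1) p ^+ (r ^ 2) * be r / qfact p (L - r)
  = \sum_(r < L.+1) \sum_(j < r.+1) F r j.
  apply: eq_bigr => r _; rewrite hb mulr_sumr mulr_suml; apply: eq_bigr => j _.
  by rewrite /F mulrA -mulrA -invfM.
rewrite sum_triangle; apply: eq_bigr => j _.
have hj : (j <= L)%N by rewrite -ltnS.
have -> : p ^+ (j ^ 2) * al j / (qfact p (L - j) * qfact p (L + j))
  = p ^+ (j ^ 2) * al j * (qfact p (L - j) * qfact p (L - j + j.*2))^-1.
  by congr (_ / (_ * qfact p _)); lia.
rewrite -qchu_vandermonde mulr_sumr; apply: eq_bigr => s _.
have hs : (s <= L - j)%N by rewrite -ltnS.
rewrite /F.
have -> : (j + s - j = s)%N by lia.
have -> : (j + s + j = s + j.*2)%N by lia.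
have -> : (L - (j + s) = L - j - s)%N by lia.
have -> : p ^+ ((j + s) ^ 2) = p ^+ (j ^ 2) * p ^+ (s * (s + j.*2)).
  by rewrite -exprD; congr (_ ^+ _); clear; nia.
have h1 := qf_neq0 s; have h2 := qf_neq0 (s + j.*2).
have h3 := qf_neq0 (L - j - s).
by field; rewrite h1 h2 h3.
Qed.

Hypothesis p0 : p != 0.

(** Both sides obey the same second-order recurrence, by [convqf_rec] and [szego_central_rec]; the
    induction carries two consecutive values. *)
Lemma convqf_szego (z : K) (g : nat -> K) (L : nat) : z != 0 ->
  szego_rec p (z + z^-1) g -> g 0%N = 1 ->
  convqf p g L = qfact p L.*2 / qfact p L * szego_central p z L.
Proof.
move=> z0 hg g0; have hC := convqf_rec p0 p_free hg.
have C0 : convqf p g 0 = 1.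
  by rewrite /convqf big_ord_recl big_ord0 addr0 g0 /= qfact0 divr1.
pose b L := qfact p L.*2 / qfact p L * szego_central p z L.
have b0 : b 0%N = 1.
  by rewrite /b /szego_central /= szego0 // !qfact0 !expr0 !divr1 !mulr1.
suff [] : convqf p g L = b L /\ convqf p g L.+1 = b L.+1 by [].
elim: L => [|L [IH1 IH2]]; split => //.
- by rewrite C0 b0.
(* [szego_central_rec] starts at index 2 only, so index 1 is verified by hand; on the other side it
   is already an instance of [hC], thanks to the padding of [delay]. *)
- have := hC 1%N; rewrite /= C0 expr1.
  rewrite /b /szego_central /= !qfactS qfact0 !expr1 => h.
  have k1 := p_free 0; have k2 := p_free 1; rewrite expr1 in k1.
  have y2 := szegoS p0 p_free z 1; have y1 := szegoS p0 p_free z 0.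
  rewrite /= !expr1 !expr0 szego0 // mulr0 addr0 mulr1 in y1.
  rewrite /= szego0 // expr1 in y2.
  have -> : szego p z 2 = (1 - p ^+ 2) * szego p z 2 / (1 - p ^+ 2) by field.
  rewrite y2.
  have -> : szego p z 1 = (1 - p) * szego p z 1 / (1 - p) by field.
  rewrite y1; apply: (mulfI k1); rewrite h; field.
  by rewrite ?k1 ?k2 ?z0 ?p0.
- have k := p_free L.+1; apply: (mulfI k); rewrite (hC L.+2) /= IH1 IH2.
  by rewrite (szego_central_rec p0 p_free L z0).
Qed.

Lemma szego_centralE (z : K) (L : nat) : z != 0 ->
  szego_central p z L
  = \sum_(j < L.+1) p ^+ (j ^ 2) * sym_pow z j / (qfact p (L - j) * qfact p (L + j)).
Proof.
move=> z0; rewrite /szego_central /szego.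
rewrite (sum_fold (fun a => z ^+ a
  / (p ^+ (a * (L.*2 - a)) * qfact p a * qfact p (L.*2 - a)))) mulrDr mulr_sumr big_ord_recl.
have zL : z ^+ L != 0 by rewrite expf_neq0.
congr (_ + _).
  rewrite /= -addnn addnK subn0 addn0 expr0 !mul1r.
  have h := qf_neq0 L; have h2 : p ^+ (L ^ 2) != 0 by rewrite expf_neq0.
  by rewrite mulnn; field; rewrite zL h h2.
apply: eq_bigr => j _; rewrite /= /bump /= add1n.
have hj : (j.+1 <= L)%N by exact: ltn_ord.
set i := j.+1 in hj *.
have -> : (L.*2 - (L + i) = L - i)%N by lia.
have -> : (L.*2 - (L - i) = L + i)%N by lia.
have -> : p ^+ (L ^ 2) = p ^+ ((L + i) * (L - i)) * p ^+ (i ^ 2).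
  by rewrite -exprD; congr (_ ^+ _); clear -hj; nia.
rewrite (mulnC (L - i)%N).
have -> : z ^+ (L - i) = z ^+ L / z ^+ i.
  by rewrite -[in RHS](subnK hj) exprD mulfK // expf_neq0.
rewrite exprD.
have h1 := qf_neq0 (L - i); have h2 := qf_neq0 (L + i).
have h3 : p ^+ ((L + i) * (L - i)) != 0 by rewrite expf_neq0.
have h4 : z ^+ i != 0 by rewrite expf_neq0.
by field; rewrite h1 h2 h3 h4 zL.
Qed.

End QSeries.

(** * The finite Jacobi triple product *)

Section TripleProduct.
Variables (K : fieldType) (h z : K).
Hypotheses (h0 : h != 0) (z0 : z != 0).
Let Q := h ^+ 2.
Hypothesis Q_free : forall k, 1 - Q ^+ k.+1 != 0.

Let qf_neq0 n : qfact Q n != 0.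
Proof. exact: qfact_neq0. Qed.

(** The q-binomial theorem in base Q = h^2. Working with the square root h makes Q^(k(k-1)/2) (x
    h)^k equal to h^(k^2) x^k. *)
Lemma qbinomial (x : K) (n : nat) :
  \prod_(k < n) (1 + x * h * Q ^+ k)
  = \sum_(k < n.+1) h ^+ (k ^ 2) * x ^+ k * qfact Q n / (qfact Q k * qfact Q (n - k)).
Proof.
elim: n => [|n IH].
  by rewrite big_ord0 big_ord_recl big_ord0 /= !qfact0 !expr0 !mulr1 divr1 addr0.
rewrite big_ord_recr /= {}IH.
pose t k := h ^+ (k ^ 2) * x ^+ k * qfact Q n / (qfact Q k * qfact Q (n.+1 - k)).
have -> : \sum_(k < n.+2) h ^+ (k ^ 2) * x ^+ k * qfact Q n.+1
      / (qfact Q k * qfact Q (n.+1 - k))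
  = \sum_(k < n.+2) (1 - Q ^+ (n.+1 - k)) * t k
    + \sum_(k < n.+2) (Q ^+ (n.+1 - k) * (1 - Q ^+ k)) * t k.
  rewrite -big_split; apply: eq_bigr => k _ /=; rewrite -mulrDl /t qfactS.
  have -> : Q ^+ n.+1 = Q ^+ (n.+1 - k) * Q ^+ k.
    by rewrite -exprD subnK // -ltnS.
  by ring.
rewrite mulrDr mulr1 mulr_suml; congr (_ + _).
  rewrite [RHS]big_ord_recr /= subnn expr0 subrr mul0r addr0; apply: eq_bigr => k _.
  rewrite /t subSn; last by rewrite -ltnS.
  set d := (n - k)%N; rewrite qfactS.
  have h1 := qf_neq0 d; have h2 := qf_neq0 k.
  by have h4 := Q_free d; field; rewrite h1 h2 h4.
rewrite [RHS]big_ord_recl /= expr0 subrr mulr0 mul0r add0r.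
apply: eq_bigr => k _; rewrite /t /= /bump /= add1n subSS.
have hk : (k <= n)%N by rewrite -ltnS.
set d := (n - k)%N; rewrite qfactS (exprS x).
have -> : h ^+ (k.+1 ^ 2) = h ^+ (k ^ 2) * h * Q ^+ k.
  by rewrite /Q -exprM -exprSr -exprD; congr (_ ^+ _); clear; nia.
have -> : Q ^+ n = Q ^+ d * Q ^+ k by rewrite -exprD /d subnK.
have h1 := qf_neq0 d; have h2 := qf_neq0 k.
by have h4 := Q_free k; field; rewrite h1 h2 h4.
Qed.

Lemma prod_negative_powers (L : nat) :
  h ^+ (L ^ 2) * \prod_(k < L) (1 + z * h / Q ^+ k.+1)
  = z ^+ L * \prod_(k < L) (1 + z^-1 * h * Q ^+ k).
Proof.
elim: L => [|L IH]; first by rewrite !big_ord0 !expr0.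
rewrite !big_ord_recr /=.
have -> : h ^+ (L.+1 ^ 2) = h ^+ (L ^ 2) * (h * Q ^+ L).
  by rewrite /Q -exprM -exprS -exprD; congr (_ ^+ _); clear; nia.
rewrite mulrACA IH (exprS z) (exprS Q).
have u0 : Q ^+ L != 0 by rewrite !expf_neq0.
rewrite /Q in u0 *; field.
by rewrite ?u0 ?h0 ?z0.
Qed.

(** The q-binomial theorem for n = 2L and x = z / Q^L. The first L factors, reversed, carry negative
    powers of Q, and [prod_negative_powers] turns them into the product in z^(-1). *)
Lemma finite_triple_product (L : nat) :
  \prod_(k < L) (1 + z * h * Q ^+ k) * \prod_(k < L) (1 + z^-1 * h * Q ^+ k)
  = \sum_(j < L.+1) h ^+ (j ^ 2) * sym_pow z j * qfact Q L.*2
       / (qfact Q (L - j) * qfact Q (L + j)).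
Proof.
have QL : Q ^+ L != 0 by rewrite !expf_neq0.
have zL : z ^+ L != 0 by rewrite expf_neq0.
have hL : h ^+ (L ^ 2) != 0 by rewrite expf_neq0.
have := qbinomial (z / Q ^+ L) L.*2.
rewrite -addnn big_split_ord /= (reindex_inj rev_ord_inj) /= addnn => e.
have {e} : \prod_(k < L) (1 + z * h / Q ^+ k.+1) * \prod_(k < L) (1 + z * h * Q ^+ k)
   = \sum_(k < L.*2.+1) h ^+ (k ^ 2) * (z / Q ^+ L) ^+ k * qfact Q L.*2
        / (qfact Q k * qfact Q (L.*2 - k)).
  rewrite -e; congr (_ * _); apply: eq_bigr => k _.
    have hk : (k.+1 <= L)%N by exact: ltn_ord.
    have -> : Q ^+ L = Q ^+ (L - k.+1) * Q ^+ k.+1 by rewrite -exprD subnK.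
    have h1 : Q ^+ (L - k.+1) != 0 by rewrite !expf_neq0.
    have h2 : Q ^+ k.+1 != 0 by rewrite !expf_neq0.
    by field; rewrite h1 h2.
  by rewrite exprD; field.
move/(congr1 (fun x => h ^+ (L ^ 2) / z ^+ L * x)).
have -> : h ^+ (L ^ 2) / z ^+ L *
    (\prod_(k < L) (1 + z * h / Q ^+ k.+1) * \prod_(k < L) (1 + z * h * Q ^+ k))
  = \prod_(k < L) (1 + z * h * Q ^+ k) * \prod_(k < L) (1 + z^-1 * h * Q ^+ k).
  rewrite mulrA -(mulrA (h ^+ _)) (mulrC (z ^+ L)^-1) mulrA prod_negative_powers.
  by field.
move=> ->.
rewrite (sum_fold (fun k => h ^+ (k ^ 2) * (z / Q ^+ L) ^+ k * qfact Q L.*2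
        / (qfact Q k * qfact Q (L.*2 - k)))) mulrDr mulr_sumr big_ord_recl; congr (_ + _).
  rewrite /= -addnn addnK subn0 addn0 expr0 expr_div_n -exprM /Q -exprM.
  have -> : (2 * (L * L) = L ^ 2 + L ^ 2)%N by rewrite mul2n -addnn mulnn.
  have h1 := qf_neq0 L.
  by rewrite exprD; field; rewrite zL hL h1.
apply: eq_bigr => j _; rewrite /= /bump /= add1n.
have hj : (j.+1 <= L)%N by exact: ltn_ord.
set i := j.+1 in hj *.
have -> : (L.*2 - (L + i) = L - i)%N by lia.
have -> : (L.*2 - (L - i) = L + i)%N by lia.
have zi : z ^+ i != 0 by rewrite expf_neq0.
have zE : z ^+ (L - i) = z ^+ L / z ^+ i.
  by rewrite -[in RHS](subnK hj) exprD mulfK.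
have powE k : h ^+ (k ^ 2) * (z / Q ^+ L) ^+ k
    = h ^+ (k ^ 2) / h ^+ (L.*2 * k) * z ^+ k.
  by rewrite expr_div_n /Q -!exprM -mul2n mulrA mulrAC.
have e1 : h ^+ ((L + i) ^ 2) / h ^+ (L.*2 * (L + i)) = h ^+ (i ^ 2) / h ^+ (L ^ 2).
  apply/eqP; rewrite eqr_div ?expf_neq0 // -!exprD; apply/eqP.
  by congr (_ ^+ _); clear; nia.
have e2 : h ^+ ((L - i) ^ 2) / h ^+ (L.*2 * (L - i)) = h ^+ (i ^ 2) / h ^+ (L ^ 2).
  apply/eqP; rewrite eqr_div ?expf_neq0 // -!exprD; apply/eqP.
  by congr (_ ^+ _); clear -hj; nia.
rewrite !powE e1 e2 zE exprD.
have h1 := qf_neq0 (L - i); have h2 := qf_neq0 (L + i).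
by field; rewrite ?h1 ?h2 ?hL ?zi ?zL.
Qed.

End TripleProduct.

(** * The finite identity for the double sum *)

Section FinalFinite.
Variables (K : fieldType) (q : K).
Hypothesis q0 : q != 0.
Hypothesis q_free : forall k, 1 - q ^+ k.+1 != 0.
Let p := q ^+ 3.

Lemma cap_bailey_pair (L : nat) :
  qfact p L * (1 + p ^+ L) / qfact p L.*2 * convqf p (cap_phi q) L
  = \sum_(j < L.+1) p ^+ (j ^ 2) * (sym_pow q^-1 j + sym_pow (q ^- 2) j)
      / (qfact p (L - j) * qfact p (L + j)).
Proof.
have p0 : p != 0 by rewrite expf_neq0.
have p_free := q3_free q_free.
have conv : (1 + p ^+ L) * convqf p (cap_phi q) L
   = convqf p (cap q 1) L + convqf p (cap_kappa q) L.
  rewrite -convqfD -(eq_convqf _ _ (cap_phiE q0 q_free)).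
  have -> : convqf p (fun k => (1 + (q ^+ 3) ^+ k) * cap_phi q k
        - (q ^+ 3) ^+ k / q ^+ 3 * delay (cap_phi q) k) L
     = convqf p (fun k => (cap_phi q k + p ^+ k * cap_phi q k)
           + (-1) * delay (fun k => p ^+ k * cap_phi q k) k) L.
    apply: eq_convqf => -[|k] /=; first by rewrite -/p; ring.
    by rewrite -/p exprS; field.
  by rewrite !convqfD convqfZ convqf_delay convqf_mulX //; ring.
have qV : q^-1 != 0 by rewrite invr_eq0.
have q2V : q ^- 2 != 0 by rewrite invr_eq0 expf_neq0.
have e1 := @convqf_szego _ p p_free p0 q^-1 (cap q 1) L qV.
have e2 := @convqf_szego _ p p_free p0 (q ^- 2) (cap_kappa q) L q2V.
have k0 : cap_kappa q 0 = 1.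
  by rewrite /cap_kappa /= cap0 // mulr0 addr0 mulr1.
rewrite !invrK in e1 e2; rewrite addrC in e1.
have {}e1 := e1 (cap1_szego q0 q_free) (cap0 q 1).
rewrite [q ^- 2 + _]addrC in e2.
have {}e2 := e2 (cap_kappa_szego q0 q_free) k0.
have h1 : qfact p L != 0 by exact: qfact_neq0.
have h2 : qfact p L.*2 != 0 by exact: qfact_neq0.
have -> : qfact p L * (1 + p ^+ L) / qfact p L.*2 * convqf p (cap_phi q) L
  = qfact p L / qfact p L.*2 * ((1 + p ^+ L) * convqf p (cap_phi q) L) by ring.
rewrite conv e1 e2.
have -> : qfact p L / qfact p L.*2 *
    (qfact p L.*2 / qfact p L * szego_central p q^-1 L +
     qfact p L.*2 / qfact p L * szego_central p (q ^- 2) L)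
  = szego_central p q^-1 L + szego_central p (q ^- 2) L by field; rewrite h1 h2.
rewrite !(szego_centralE p_free p0) // -big_split; apply: eq_bigr => j _ /=.
by rewrite mulrDr mulrDl.
Qed.

End FinalFinite.

(** * Convergence in the complex numbers *)

Section ComplexNorm.
Variable R : realType.
Implicit Types (x y z : R[i]).

Lemma normr_normc z : `|z| = (normc z)%:C%C.
Proof. by []. Qed.

Lemma normc_ge0 z : 0 <= normc z.
Proof. by case: z => a b; exact: sqrtr_ge0. Qed.

Lemma normc_triangle x y : normc (x + y) <= normc x + normc y.
Proof. exact: (@le_normcD R x y). Qed.

Lemma normc_opp x : normc (- x) = normc x.
Proof. exact: (@normcN R x). Qed.

Lemma normc_exp x n : normc (x ^+ n) = normc x ^+ n.
Proof.
by elim: n => [|n IH]; rewrite ?expr0 ?normc1 // !exprS normcM IH.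
Qed.

Lemma normc_prod (I : Type) (s : seq I) (F : I -> R[i]) :
  normc (\prod_(i <- s) F i) = \prod_(i <- s) normc (F i).
Proof.
by elim/big_rec2: _ => [|i y x _ <-]; rewrite ?normc1 // normcM.
Qed.

Lemma normc_sum (I : Type) (s : seq I) (P : pred I) (F : I -> R[i]) :
  normc (\sum_(i <- s | P i) F i) <= \sum_(i <- s | P i) normc (F i).
Proof.
elim/big_rec2: _ => [|i y x _ IH]; first by rewrite normc0.
by apply: le_trans (normc_triangle _ _) _; rewrite lerD2l.
Qed.

Lemma normc_le_ReIm z : normc z <= `|complex.Re z| + `|complex.Im z|.
Proof.
case: z => a b /=; rewrite -ler_sqr ?nnegrE ?sqrtr_ge0 ?addr_ge0 //.
rewrite sqr_sqrtr ?addr_ge0 ?sqr_ge0 // sqrrD -!normrX.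
rewrite (ger0_norm (sqr_ge0 a)) (ger0_norm (sqr_ge0 b)) addrAC lerDl.
by rewrite mulrn_wge0 // mulr_ge0.
Qed.

Lemma normRe_le z : `|complex.Re z| <= normc z.
Proof.
case: z => a b /=; rewrite -(sqrtr_sqr a) ler_wsqrtr //.
by rewrite lerDl sqr_ge0.
Qed.

Lemma normIm_le z : `|complex.Im z| <= normc z.
Proof.
case: z => a b /=; rewrite -(sqrtr_sqr b) ler_wsqrtr //.
by rewrite lerDr sqr_ge0.
Qed.

(** Replaces the epsilon of R[i], a complex number, by a real one, so that all estimates take place
    in R. The filter is arbitrary because both sequences and unordered sums are treated. *)
Lemma cvg_normcP (T : Type) (F : set_system T) (FF : Filter F) (u : T -> R[i]) (l : R[i]) :
  (u : T -> R[i]^o) @ F --> (l : R[i]^o)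
  <-> forall e : R, 0 < e -> \forall t \near F, normc (l - u t) < e.
Proof.
split=> [/cvgrPdist_lt h e e0|h].
  have e0' : 0 < e%:C%C :> R[i] by rewrite ltcR.
  by apply: filterS (h _ e0') => t /=; rewrite normr_normc ltcR.
apply/cvgrPdist_lt => e e0.
have eE : e = (complex.Re e)%:C%C by rewrite RRe_real // gtr0_real.
have e0' : 0 < complex.Re e by rewrite -ltcR -eE.
by apply: filterS (h _ e0') => t /=; rewrite normr_normc [in X in _ -> X]eE ltcR.
Qed.

Lemma cvg_normc0 (u : nat -> R[i]) :
  (u : nat -> R[i]^o) @ \oo --> (0 : R[i]^o)
  <-> (fun n => normc (u n)) @ \oo --> (0 : R).
Proof.
split=> [/cvg_normcP h|/cvgr0Pnorm_lt h].
  apply/cvgr0Pnorm_lt => e e0; apply: filterS (h e e0) => t.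
  by rewrite sub0r normc_opp ger0_norm ?normc_ge0.
apply/cvg_normcP => e e0; apply: filterS (h e e0) => t.
by rewrite sub0r normc_opp ger0_norm ?normc_ge0.
Qed.

Lemma geometric_increments_cvg_real (u : nat -> R) (c r : R) :
  0 <= r < 1 -> (forall n, `|u n.+1 - u n| <= c * r ^+ n) ->
  cvg (u @ \oo).
Proof.
move=> /andP[r0 r1] hu.
have -> : u = (fun n => u 0%N + series (telescope u) n).
  by apply/funext => n; exact: eq_sum_telescope.
apply: is_cvgD; first exact: is_cvg_cst.
apply: normed_cvg; apply: (@series_le_cvg _ _ (geometric c r)).
- by move=> n; exact: normr_ge0.
- by move=> n; exact: le_trans (normr_ge0 _) (hu n).
- by move=> n; exact: hu.
- by apply: is_cvg_geometric_series; rewrite ger0_norm.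
Qed.

(** The real and imaginary parts are telescoping series dominated by a geometric one. *)
Lemma geometric_increments_cvg (u : nat -> R[i]) (c r : R) :
  0 <= r < 1 -> (forall n, normc (u n.+1 - u n) <= c * r ^+ n) ->
  cvg ((u : nat -> R[i]^o) @ \oo).
Proof.
move=> r01 hu.
have hRe : cvg ((fun n => complex.Re (u n)) @ \oo).
  apply: (geometric_increments_cvg_real r01) => n; apply: le_trans (hu n).
  by apply: le_trans (normRe_le _); rewrite raddfB.
have hIm : cvg ((fun n => complex.Im (u n)) @ \oo).
  apply: (geometric_increments_cvg_real r01) => n; apply: le_trans (hu n).
  by apply: le_trans (normIm_le _); rewrite raddfB.
set a := lim ((fun n => complex.Re (u n)) @ \oo) in hRe.
set b := lim ((fun n => complex.Im (u n)) @ \oo) in hIm.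
apply/cvg_ex; exists (a +i* b)%C; apply/cvg_normcP => e e0.
have e2 : 0 < e / 2 by rewrite divr_gt0.
have /cvgrPdist_lt/(_ _ e2) h1 := hRe; have /cvgrPdist_lt/(_ _ e2) h2 := hIm.
near=> n; apply: le_lt_trans (normc_le_ReIm _) _; rewrite !raddfB /= (splitr e).
by apply: ltrD; near: n.
Unshelve. all: by end_near.
Qed.

End ComplexNorm.

(** * Dominated convergence *)

Section Tannery.
Variable R : realType.

Lemma sum_expr_le (r : R) n : 0 <= r < 1 -> \sum_(k < n) r ^+ k <= (1 - r)^-1.
Proof.
move=> /andP[r0 r1]; have r1' : 0 < 1 - r by rewrite subr_gt0.
rewrite -[leRHS]mul1r ler_pdivlMr // mulrC.
have := subrX1 r n; set s := \sum_(i < n) _ => h.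
have : 0 <= r ^+ n by rewrite exprn_ge0.
by nra.
Qed.

(** Tannery's theorem with limit 0: the domination, uniform in L, makes the terms beyond some J
    small, and the first J terms are finitely many null sequences. *)
Lemma tannery0 (a : nat -> nat -> R[i]) (c r : R) : 0 <= r < 1 ->
  (forall L j, (j <= L)%N -> normc (a L j) <= c * r ^+ j) ->
  (forall j, ((fun L => a L j) : nat -> R[i]^o) @ \oo --> (0 : R[i]^o)) ->
  ((fun L => \sum_(j < L.+1) a L j) : nat -> R[i]^o) @ \oo --> (0 : R[i]^o).
Proof.
move=> r01 ha h0; have /andP[r0 r1] := r01.
have c0 : 0 <= c.
  by have := ha 0%N 0%N (leqnn _); rewrite expr0 mulr1; apply: le_trans; exact: normc_ge0.
apply/cvg_normcP => e e0.
have e2 : 0 < e / 2 by rewrite divr_gt0.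
have [J hJ] : exists J, c * r ^+ J / (1 - r) < e / 2.
  have : (fun n => c * r ^+ n / (1 - r)) @ \oo --> (0 : R).
    rewrite -[X in _ --> X](mul0r (1 - r)^-1); apply: cvgMl.
    rewrite -[X in _ --> X](mulr0 c); apply: cvgMr; apply: cvg_expr.
    by rewrite ger0_norm.
  move=> /cvgr0Pnorm_lt/(_ _ e2) [J _ /(_ J (leqnn _)) h].
  by exists J; apply: le_lt_trans h; exact: ler_norm.
have hS : ((fun L => \sum_(j < J) a L j) : nat -> R[i]^o) @ \oo --> (0 : R[i]^o).
  elim: J {hJ} => [|J IH].
    by under eq_fun do rewrite big_ord0; exact: cvg_cst.
  have -> : (fun L => \sum_(j < J.+1) a L j) = (fun L => \sum_(j < J) a L j + a L J).
    by apply/funext => L; rewrite big_ord_recr.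
  have h := cvgD IH (h0 J); rewrite addr0 in h.
  exact: h.
have /cvg_normcP/(_ _ e2) h1 := hS.
near=> L.
have hL : (J <= L.+1)%N by near: L; exists J => // n /= /leqW.
rewrite sub0r normc_opp (splitr e).
have -> : \sum_(j < L.+1) a L j
  = \sum_(j < J) a L j + \sum_(J <= j < L.+1) a L j.
  by rewrite -!(big_mkord xpredT) -big_cat_nat.
apply: le_lt_trans (normc_triangle _ _) _; apply: ltrD.
  by rewrite -normc_opp -sub0r; near: L.
apply: le_lt_trans hJ; apply: le_trans (normc_sum _ _ _) _.
apply: (@le_trans _ _ (\sum_(J <= j < L.+1) c * r ^+ j)).
  by rewrite !big_nat; apply: ler_sum => j /andP[_ hj]; apply: ha.
rewrite -mulrA -mulr_sumr; apply: ler_wpM2l => //.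
rewrite -{1}(add0n J) big_addn big_mkord.
under eq_bigr do rewrite exprD.
rewrite -mulr_suml mulrC; apply: ler_wpM2l; first by rewrite exprn_ge0.
exact: sum_expr_le.
Unshelve. all: by end_near.
Qed.

Lemma gaussian_le_geometric (D r : R) : 0 <= D -> 0 <= r < 1 ->
  exists c, forall n, D ^+ n * r ^+ (n ^ 2) <= c * 2^-1 ^+ n.
Proof.
move=> D0 /andP[r0 r1].
have [k hk] : exists k, D * r ^+ k < 2^-1.
  have : (fun n => D * r ^+ n) @ \oo --> (0 : R).
    rewrite -[X in _ --> X](mulr0 D); apply: cvgMr; apply: cvg_expr.
    by rewrite ger0_norm.
  have e2 : 0 < 2^-1 :> R by rewrite invr_gt0.
  move=> /cvgr0Pnorm_lt/(_ _ e2) [J _ /(_ J (leqnn _)) h].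
  by exists J; apply: le_lt_trans h; exact: ler_norm.
(* From k on, D r^n < 1/2 gives the bound 2^(-n); the constant only has to absorb the n below k,
   where the term is at most (D + 1)^n. *)
exists ((2 * (D + 1)) ^+ k) => n.
have D1 : 1 <= 2 * (D + 1) by lra.
have -> : D ^+ n * r ^+ (n ^ 2) = (D * r ^+ n) ^+ n.
  by rewrite exprMn -exprM mulnn.
have Dr0 j : 0 <= D * r ^+ j by rewrite mulr_ge0 ?exprn_ge0.
have h0 : 0 <= 2^-1 ^+ n :> R by rewrite exprn_ge0 // invr_ge0.
have [kn|nk] := leqP k n.
  apply: (@le_trans _ _ (2^-1 ^+ n)).
    apply: lerXn2r; rewrite ?nnegrE ?Dr0 ?invr_ge0 //.
    apply: le_trans (ltW hk); apply: ler_wpM2l => //.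
    by apply: ler_wiXn2l => //; exact: ltW.
  by rewrite ler_peMl // exprn_ege1.
apply: (@le_trans _ _ ((D + 1) ^+ n)).
  apply: lerXn2r; rewrite ?nnegrE ?Dr0 ?addr_ge0 //.
  apply: (@le_trans _ _ D); last by rewrite lerDl.
  by rewrite ler_piMr // exprn_ile1 // ltW.
have -> : (D + 1) ^+ n = (2 * (D + 1)) ^+ n * 2^-1 ^+ n.
  by rewrite -exprMn mulrAC divff ?mul1r // pnatr_eq0.
by apply: ler_wpM2r => //; apply: ler_weXn2l => //; exact: ltnW.
Qed.

End Tannery.

(** * Bounds and limits of q-factorials *)

Section QPochhammerLimits.
Variable R : realType.
Implicit Types (a p : R[i]).

Lemma qpoch_bound a p : normc p < 1 ->
  exists2 c : R, 0 < c & forall n, normc (qpoch a p n) <= c.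
Proof.
move=> p1; have r01 : 0 <= normc p < 1 by rewrite normc_ge0.
exists (expR (normc a / (1 - normc p))); first exact: expR_gt0.
move=> n; rewrite /qpoch normc_prod.
apply: (@le_trans _ _ (\prod_(k < n) expR (normc a * normc p ^+ k))).
  apply: ler_prod => k _; rewrite normc_ge0 /=.
  apply: le_trans (normc_triangle _ _) _.
  by rewrite normc1 normc_opp normcM normc_exp expR_ge1Dx.
rewrite -expR_sum -mulr_sumr ler_expR ler_wpM2l ?normc_ge0 //.
exact: sum_expr_le.
Qed.

Lemma inv_qfact_bound p : normc p < 1 ->
  exists2 c : R, 0 < c & forall n, normc (qfact p n)^-1 <= c.
Proof.
move=> p1; set r := normc p in p1.
have r0 : 0 <= r by exact: normc_ge0.
have r01 : 0 <= r < 1 by rewrite r0.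
have d0 : 0 < 1 - r by rewrite subr_gt0.
(* Each inverse factor satisfies 1/(1 - r^(k+1)) <= 1 + r/(1 - r) r^k <= exp(r/(1 - r) r^k), and the
   exponents add up to at most r/(1 - r)/(1 - r). *)
exists (expR (r / (1 - r) / (1 - r))); first exact: expR_gt0.
move=> n; rewrite normcV /qfact normc_prod -prodfV.
apply: (@le_trans _ _ (\prod_(k < n) expR (r / (1 - r) * r ^+ k))).
  apply: ler_prod => k _; rewrite invr_ge0 normc_ge0 /= -exprS.
  apply: le_trans (expR_ge1Dx _).
  have x0 : 0 <= r ^+ k by rewrite exprn_ge0.
  have x1 : r ^+ k <= 1 by rewrite exprn_ile1 // ltW.
  have h : 1 - r * r ^+ k <= normc (1 - p ^+ k.+1).
    have := normc_triangle (1 - p ^+ k.+1) (p ^+ k.+1).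
    by rewrite subrK normc1 normc_exp -/r (exprS r); lra.
  have h1 : 0 < 1 - r * r ^+ k by nra.
  apply: (@le_trans _ _ (1 - r * r ^+ k)^-1); first by rewrite lef_pV2 // posrE; lra.
  rewrite -[leLHS]mul1r ler_pdivrMr //.
  have -> : (1 + r / (1 - r) * r ^+ k) * (1 - r * r ^+ k)
     = 1 + r * r ^+ k * (r - r * r ^+ k) / (1 - r) by field; rewrite gt_eqF.
  rewrite lerDl; apply: divr_ge0; last exact: ltW.
  by apply: mulr_ge0; [exact: mulr_ge0 | nra].
rewrite -expR_sum -mulr_sumr ler_expR ler_wpM2l ?divr_ge0 ?(ltW d0) //.
exact: sum_expr_le.
Qed.

Lemma qpoch_cvg a p : normc p < 1 ->
  ((fun n => qpoch a p n) : nat -> R[i]^o) @ \oo --> qpoch_infty a p.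
Proof.
move=> p1; have [c c0 hc] := qpoch_bound a p1.
apply: (@geometric_increments_cvg R _ (c * normc a) (normc p)).
  by rewrite normc_ge0.
move=> n; rewrite /qpoch big_ord_recr /= -/(qpoch a p n) mulrBr mulr1.
rewrite addrAC subrr sub0r normc_opp !normcM normc_exp mulrA.
by rewrite ler_wpM2r ?exprn_ge0 ?normc_ge0 // ler_wpM2r ?normc_ge0.
Qed.

Lemma qfact_cvg p : normc p < 1 ->
  (qfact p : nat -> R[i]^o) @ \oo --> qpoch_infty p p.
Proof. exact: qpoch_cvg. Qed.

Lemma qfact_bound p : normc p < 1 ->
  exists2 c : R, 0 < c & forall n, normc (qfact p n) <= c.
Proof. exact: qpoch_bound. Qed.

Lemma free_of_normc_lt1 p : normc p < 1 -> forall k, 1 - p ^+ k.+1 != 0.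
Proof.
move=> p1 k; rewrite subr_eq0; apply/eqP => /(congr1 (@normc R)).
rewrite normc1 normc_exp => h.
have : normc p ^+ k.+1 < 1 by rewrite exprn_ilt1 ?normc_ge0.
by rewrite -h ltxx.
Qed.

(** A zero limit would make 1/(p;p)_n unbounded, against [inv_qfact_bound]. *)
Lemma qpoch_infty_neq0 p : normc p < 1 -> qpoch_infty p p != 0.
Proof.
move=> p1; apply/eqP => h; have := qfact_cvg p1; rewrite h => /cvg_normc0.
have [c c0 hc] := inv_qfact_bound p1.
move=> /cvgr0Pnorm_lt/(_ c^-1); rewrite invr_gt0 => /(_ c0) [n _ /(_ n (leqnn _))].
rewrite /= ger0_norm ?normc_ge0 // => lt_c.
have h0 : qfact p n != 0 by apply: qfact_neq0; exact: free_of_normc_lt1.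
have hn : 0 < normc (qfact p n).
  rewrite lt_neqAle normc_ge0 eq_sym andbT.
  by apply: contra h0 => /eqP /eq0_normc ->.
have := hc n; rewrite normcV -[c]invrK lef_pV2 ?posrE ?invr_gt0 // => le_c.
by have := le_lt_trans le_c lt_c; rewrite ltxx.
Qed.

End QPochhammerLimits.

(** * Letting L tend to infinity in Bailey-type identities *)

Section BaileyLimits.
Variables (R : realType) (p : R[i]).
Hypothesis p1 : normc p < 1.
Let P : R[i] := qpoch_infty p p.

Definition geometric_bounded (a : nat -> R[i]) : Prop :=
  exists c r : R, 0 <= r < 1 /\ forall j, normc (a j) <= c * r ^+ j.

Lemma tannery0_weighted (a : nat -> R[i]) (w : nat -> nat -> R[i]) (b : R) :
  geometric_bounded a -> (forall L j, normc (w L j) <= b) ->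
  (forall j, ((fun L => w L j) : nat -> R[i]^o) @ \oo --> (0 : R[i]^o)) ->
  ((fun L => \sum_(j < L.+1) a j * w L j) : nat -> R[i]^o) @ \oo --> (0 : R[i]^o).
Proof.
move=> [c [r [r01 ha]]] hw w0.
apply: (@tannery0 R (fun L j => a j * w L j) (c * b) r r01) => [L j _|j].
  by rewrite normcM mulrAC; apply: ler_pM; rewrite ?normc_ge0.
have h := cvgM (cvg_cst (a j : R[i]^o)) (w0 j).
by rewrite mulr0 in h; exact: h.
Qed.

Lemma qfact_sub_cvg j :
  ((fun L => qfact p (L - j)) : nat -> R[i]^o) @ \oo --> (P : R[i]^o).
Proof. exact: (cvg_comp _ _ (cvg_subnr j) (qfact_cvg p1)). Qed.

Lemma qfact_add_cvg j :
  ((fun L => qfact p (L + j)) : nat -> R[i]^o) @ \oo --> (P : R[i]^o).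
Proof. exact: (cvg_comp _ _ (cvg_addnr j) (qfact_cvg p1)). Qed.

Lemma qfact_double_cvg :
  ((fun L => qfact p L.*2) : nat -> R[i]^o) @ \oo --> (P : R[i]^o).
Proof.
have h := cvg_comp _ _ (@cvg_mulnl 2 isT) (qfact_cvg p1).
have -> : (fun L => qfact p L.*2) = qfact p \o muln 2.
  by apply/funext => L /=; rewrite mul2n.
exact: h.
Qed.

Let P0 : P != 0. Proof. exact: qpoch_infty_neq0. Qed.

Lemma qfact_subV_cvg j :
  ((fun L => (qfact p (L - j))^-1) : nat -> R[i]^o) @ \oo --> (P^-1 : R[i]^o).
Proof. exact: (cvgV P0 (qfact_sub_cvg j)). Qed.

Lemma qfact_addV_cvg j :
  ((fun L => (qfact p (L + j))^-1) : nat -> R[i]^o) @ \oo --> (P^-1 : R[i]^o).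
Proof. exact: (cvgV P0 (qfact_add_cvg j)). Qed.

(** The sequence [u] is kept general for two uses: (p;p)_L in the Bailey limit and (p;p)_(2L) in the
    triple product. Both tend to P, so the weight P u_L / ((p;p)_(L-j) (p;p)_(L+j)) tends to 1. *)
Lemma bailey_rhs_limit (a u : nat -> R[i]) (b : R) : geometric_bounded a ->
  (forall L, normc (u L) <= b) ->
  (u : nat -> R[i]^o) @ \oo --> (P : R[i]^o) ->
  ((fun L => \sum_(j < L.+1) a j
     - P * (u L * \sum_(j < L.+1) a j / (qfact p (L - j) * qfact p (L + j))))
    : nat -> R[i]^o) @ \oo --> (0 : R[i]^o).
Proof.
move=> ha ub uP; have [c c0 hc] := inv_qfact_bound p1.
pose w L j := 1 - P * u L / (qfact p (L - j) * qfact p (L + j)).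
have -> : (fun L => \sum_(j < L.+1) a j
     - P * (u L * \sum_(j < L.+1) a j / (qfact p (L - j) * qfact p (L + j))))
  = (fun L => \sum_(j < L.+1) a j * w L j).
  apply/funext => L; rewrite !mulr_sumr -sumrB; apply: eq_bigr => j _.
  by rewrite /w; ring.
apply: (@tannery0_weighted a w (1 + normc P * b * (c * c)) ha) => [L j|j].
  apply: le_trans (normc_triangle _ _) _; rewrite normc1 lerD2l normc_opp.
  rewrite invfM !normcM; have b0 : 0 <= b by apply: le_trans (ub 0%N); exact: normc_ge0.
  apply: ler_pM; rewrite ?mulr_ge0 ?normc_ge0 //.
    by rewrite ler_wpM2l ?normc_ge0.
  by apply: ler_pM; rewrite ?normc_ge0.
have h1 := qfact_subV_cvg j; have h2 := qfact_addV_cvg j.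
have h := cvgB (cvg_cst (1 : R[i]^o)) (cvgM (cvgM (cvg_cst (P : R[i]^o)) uP) (cvgM h1 h2)).
have e : 1 - P * P * (P^-1 * P^-1) = 0 :> R[i]^o.
  by have := P0 => hP; field.
rewrite e in h.
have -> : (fun L => w L j)
  = (fun L => 1 - P * u L * ((qfact p (L - j))^-1 * (qfact p (L + j))^-1)).
  by apply/funext => L; rewrite /w invfM.
exact: h.
Qed.

Lemma bailey_lhs_limit (s : nat -> R[i]) : geometric_bounded s ->
  ((fun L => \sum_(N < L.+1) s N - qfact p L * \sum_(N < L.+1) s N / qfact p (L - N))
    : nat -> R[i]^o) @ \oo --> (0 : R[i]^o).
Proof.
move=> hs; have [c c0 hc] := inv_qfact_bound p1; have [b b0 hb] := qfact_bound p1.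
pose w L N := 1 - qfact p L / qfact p (L - N).
have -> : (fun L => \sum_(N < L.+1) s N - qfact p L * \sum_(N < L.+1) s N / qfact p (L - N))
  = (fun L => \sum_(N < L.+1) s N * w L N).
  apply/funext => L; rewrite !mulr_sumr -sumrB; apply: eq_bigr => j _.
  by rewrite /w; ring.
apply: (@tannery0_weighted s w (1 + b * c) hs) => [L j|j].
  apply: le_trans (normc_triangle _ _) _; rewrite normc1 lerD2l normc_opp normcM.
  by apply: ler_pM; rewrite ?normc_ge0.
have h1 := qfact_subV_cvg j.
have h := cvgB (cvg_cst (1 : R[i]^o)) (cvgM (qfact_cvg p1) h1).
have e : 1 - P * P^-1 = 0 :> R[i]^o by have := P0 => hP; field.
rewrite e in h; exact: h.
Qed.

(** After multiplication by (p;p)_L the weights tend to 1 on the left and to 1/P on the right.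
    Comparing differences with 0 makes the convergence of the left-hand series a conclusion. *)
Lemma bailey_limit (s a : nat -> R[i]) (T : R[i]) :
  geometric_bounded s -> geometric_bounded a ->
  (forall L, \sum_(N < L.+1) s N / qfact p (L - N)
     = \sum_(j < L.+1) a j / (qfact p (L - j) * qfact p (L + j))) ->
  ((fun L => \sum_(j < L.+1) a j) : nat -> R[i]^o) @ \oo --> (T : R[i]^o) ->
  ((fun L => \sum_(N < L.+1) s N) : nat -> R[i]^o) @ \oo --> (T / P : R[i]^o).
Proof.
move=> hs ha e hT; have [b b0 hb] := qfact_bound p1.
have h1 := bailey_lhs_limit hs; have h2 := bailey_rhs_limit ha hb (qfact_cvg p1).
have h3 := cvgD h1 (cvgM (cvgB hT h2) (cvg_cst (P^-1 : R[i]^o))).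
rewrite add0r subr0 in h3.
have -> : (fun L => \sum_(N < L.+1) s N) = (fun L =>
  (\sum_(N < L.+1) s N - qfact p L * \sum_(N < L.+1) s N / qfact p (L - N))
  + (\sum_(j < L.+1) a j - (\sum_(j < L.+1) a j
     - P * (qfact p L * \sum_(j < L.+1) a j / (qfact p (L - j) * qfact p (L + j))))) / P).
  by apply/funext => L; rewrite e subKr mulrAC mulfV // mul1r subrK.
exact: h3.
Qed.

End BaileyLimits.

Lemma jacobi_triple_product (R : realType) (h z : R[i]) : h != 0 -> z != 0 ->
  normc h < 1 -> geometric_bounded (fun j => h ^+ (j ^ 2) * sym_pow z j) ->
  ((fun L => \sum_(j < L.+1) h ^+ (j ^ 2) * sym_pow z j) : nat -> R[i]^o) @ \oo -->
  (qpoch_infty (h ^+ 2) (h ^+ 2)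
   * (qpoch_infty (- (z * h)) (h ^+ 2) * qpoch_infty (- (z^-1 * h)) (h ^+ 2)) : R[i]^o).
Proof.
move=> h0 z0 h1 hb; set Q := h ^+ 2.
have Q1 : normc Q < 1 by rewrite normc_exp exprn_ilt1 ?normc_ge0.
have [c c0 hc] := qfact_bound Q1.
have l1 := bailey_rhs_limit Q1 hb (fun L => hc L.*2) (qfact_double_cvg Q1).
have l2 : ((fun L => qpoch_infty Q Q * (qpoch (- (z * h)) Q L * qpoch (- (z^-1 * h)) Q L))
    : nat -> R[i]^o) @ \oo --> (qpoch_infty Q Q
   * (qpoch_infty (- (z * h)) Q * qpoch_infty (- (z^-1 * h)) Q) : R[i]^o).
  by apply: cvgM; [exact: cvg_cst | apply: cvgM; exact: qpoch_cvg].
have l3 := cvgD l1 l2; rewrite add0r in l3.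
have -> : (fun L => \sum_(j < L.+1) h ^+ (j ^ 2) * sym_pow z j) = (fun L =>
  (\sum_(j < L.+1) h ^+ (j ^ 2) * sym_pow z j - qpoch_infty Q Q
     * (qfact Q L.*2 * \sum_(j < L.+1) h ^+ (j ^ 2) * sym_pow z j
        / (qfact Q (L - j) * qfact Q (L + j))))
  + qpoch_infty Q Q * (qpoch (- (z * h)) Q L * qpoch (- (z^-1 * h)) Q L)).
  apply/funext => L; rewrite /qpoch.
  have -> : \prod_(k < L) (1 - - (z * h) * Q ^+ k) = \prod_(k < L) (1 + z * h * Q ^+ k).
    by apply: eq_bigr => k _; rewrite mulNr opprK.
  have -> : \prod_(k < L) (1 - - (z^-1 * h) * Q ^+ k) = \prod_(k < L) (1 + z^-1 * h * Q ^+ k).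
    by apply: eq_bigr => k _; rewrite mulNr opprK.
  rewrite (finite_triple_product h0 z0 (free_of_normc_lt1 Q1)).
  have -> : qfact Q L.*2 * \sum_(j < L.+1) h ^+ (j ^ 2) * sym_pow z j
        / (qfact Q (L - j) * qfact Q (L + j))
    = \sum_(j < L.+1) h ^+ (j ^ 2) * sym_pow z j * qfact Q L.*2
        / (qfact Q (L - j) * qfact Q (L + j)).
    by rewrite mulr_sumr; apply: eq_bigr => j _; ring.
  by rewrite subrK.
exact: l3.
Qed.

(** * Unordered sums from graded partial sums *)

Lemma uniq_flatten_graded (A T : eqType) (s : seq A) (E : A -> seq T) (rk : T -> A) :
  uniq s -> (forall a, uniq (E a)) -> (forall a t, t \in E a -> rk t = a) ->
  uniq (flatten [seq E a | a <- s]).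
Proof.
move=> us uE hrk; elim: s us => //= a s IH /andP[as_ us].
rewrite cat_uniq uE IH // andbT.
apply/hasPn => t /flattenP[_ /mapP[a' a's ->] ta']; apply/negP => /= ta.
by move: as_; rewrite -(hrk _ _ ta) (hrk _ _ ta') a's.
Qed.

Section GradedSums.
Variables (R : realType) (T : choiceType) (F : T -> R[i]) (E : nat -> seq T) (rk : T -> nat).
Hypothesis E_uniq : forall N, uniq (E N).
Hypothesis E_rk : forall N t, t \in E N -> rk t = N.
Hypothesis E_supp : forall t, F t != 0 -> t \in E (rk t).

Lemma sum_uniq_sub (V : nmodType) (s1 s2 : seq T) (G : T -> V) :
  uniq s1 -> uniq s2 -> {subset s2 <= s1} ->
  \sum_(t <- s1 | t \in s2) G t = \sum_(t <- s2) G t.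
Proof.
move=> u1 u2 h; rewrite -big_filter; apply: perm_big; apply: uniq_perm => //.
  by rewrite filter_uniq.
by move=> t; rewrite mem_filter; case: (boolP (t \in s2)) => // /h ->.
Qed.

(** [E N] lists a finite part of rank N outside which F vanishes. A finite set containing all [E N]
    with N <= L adds to their sum only terms of higher rank, which the geometric bound controls. *)
Lemma graded_sum_cvg (c r : R) (l : R[i]) : 0 <= r < 1 ->
  (forall N, \sum_(t <- E N) normc (F t) <= c * r ^+ N) ->
  ((fun L => \sum_(N < L.+1) \sum_(t <- E N) F t) : nat -> R[i]^o) @ \oo --> (l : R[i]^o) ->
  partial_sum (F : T -> R[i]^o) @ totally --> (l : R[i]^o).
Proof.
move=> r01 hb hl; have /andP[r0 r1] := r01.
have c0 : 0 <= c.
  have := hb 0%N; rewrite expr0 mulr1; apply: le_trans.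
  by apply: sumr_ge0 => t _; exact: normc_ge0.
have FF : Filter (@totally T) by exact: (@totally_filter T).
apply/(@cvg_normcP R _ _ FF) => e e0.
have e2 : 0 < e / 2 by rewrite divr_gt0.
have tail0 : (fun n => c * r ^+ n.+1 / (1 - r)) @ \oo --> (0 : R).
  rewrite -[X in _ --> X](mul0r (1 - r)^-1); apply: cvgMl.
  rewrite -[X in _ --> X](mulr0 c); apply: cvgMr.
  have := @cvg_expr R r; rewrite ger0_norm // => /(_ r1).
  by rewrite -(cvg_shiftS (GRing.exp r)).
have [L [hL1 hL2]] : exists L,
    normc (l - \sum_(N < L.+1) \sum_(t <- E N) F t) < e / 2
    /\ c * r ^+ L.+1 / (1 - r) < e / 2.
  have /cvg_normcP/(_ _ e2) n1 := hl.
  have /cvgr0Pnorm_lt/(_ _ e2) n2 := tail0.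
  have [L _ /(_ L (leqnn _)) [m1 m2]] := filterI n1 n2.
  by exists L; split => //; apply: le_lt_trans m2; exact: ler_norm.
pose Es := flatten [seq E N | N <- iota 0 L.+1].
exists [fset t in Es]%fset => // B /fsubsetP /= hB.
have EsB : {subset Es <= B} by move=> t ht; apply: hB; rewrite in_fset.
have Es_uniq : uniq Es by apply: (uniq_flatten_graded _ E_uniq E_rk); exact: iota_uniq.
have sumE : \sum_(N < L.+1) \sum_(t <- E N) F t = \sum_(t <- Es) F t.
  by rewrite big_flatten big_map -(big_mkord xpredT (fun N => \sum_(t <- E N) F t)) /index_iota subn0.
rewrite sumE in hL1.
have -> : partial_sum F B = \sum_(t <- Es) F t + \sum_(t <- B | t \notin Es) F t.
  rewrite /partial_sum -(big_seq_fsetE _ _ xpredT F) /= (bigID (mem Es)) /=.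
  by rewrite sum_uniq_sub.
rewrite opprD addrA (splitr e); apply: le_lt_trans (normc_triangle _ _) _.
apply: ltrD => //; rewrite normc_opp; apply: le_lt_trans hL2.
apply: le_trans (normc_sum _ _ _) _.
(* M exceeds every rank in B, so the nonzero leftover terms lie in the blocks from L + 1 to M -
   1. *)
pose M := (\max_(t <- B) rk t).+1.
pose Et := flatten [seq E N | N <- index_iota L.+1 M].
have Et_uniq : uniq Et by apply: (uniq_flatten_graded _ E_uniq E_rk); exact: iota_uniq.
pose s2 := [seq t <- B | (t \notin Es) && (F t != 0)].
have s2_uniq : uniq s2 by rewrite filter_uniq.
have s2_Et : {subset s2 <= Et}.
  move=> t; rewrite mem_filter => /andP[/andP[tEs Ft] tB].
  apply/flattenP; exists (E (rk t)); last exact: E_supp.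
  apply: map_f; rewrite mem_index_iota ltnS; apply/andP; split; last first.
    exact: (@leq_bigmax_seq _ _ xpredT rk t).
  rewrite ltnNge; apply: contra tEs => hr.
  apply/flattenP; exists (E (rk t)); last exact: E_supp.
  by apply: map_f; rewrite mem_iota.
have -> : \sum_(t <- B | t \notin Es) normc (F t) = \sum_(t <- s2) normc (F t).
  rewrite big_filter (bigID (fun t => F t == 0)) /= big1 ?add0r //.
  by move=> t /andP[_ /eqP ->]; rewrite normc0.
apply: (@le_trans _ _ (\sum_(t <- Et) normc (F t))).
  rewrite [leRHS](bigID (mem s2)) /= sum_uniq_sub // lerDl.
  by apply: sumr_ge0 => t _; exact: normc_ge0.
rewrite big_flatten big_map.
apply: (@le_trans _ _ (\sum_(L.+1 <= N < M) c * r ^+ N)).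
  by apply: ler_sum => N _.
rewrite -mulrA -mulr_sumr; apply: ler_wpM2l => //.
have [hM|hM] := leqP M L.+1.
  rewrite big_geq // mulr_ge0 ?exprn_ge0 // invr_ge0 subr_ge0 ltW //.
rewrite -{1}(add0n L.+1) big_addn big_mkord.
under eq_bigr do rewrite exprD.
rewrite -mulr_suml mulrC; apply: ler_wpM2l; first by rewrite exprn_ge0.
exact: sum_expr_le.
Qed.

End GradedSums.

(** * The multiple sum *)

(** The outer index r is N_2 when N is N_1, so the recursion is exactly one step of the Bailey
    chain. The tuples have f + 1 entries because the number of entries is positive. *)
Fixpoint compositions (f N : nat) : seq (f.+1.-tuple nat) :=
  match f with
  | 0 => [:: [tuple N]]
  | f'.+1 => [seq cons_tuple (N - r)%N c | r <- iota 0 N.+1, c <- compositions f' r]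
  end.

Lemma mem_compositions f N (c : f.+1.-tuple nat) :
  (c \in compositions f N) = (sumn c == N).
Proof.
elim: f N c => [|f IH] N c.
  case/tupleP: c => x c; rewrite (tuple0 c) inE /= addn0.
  by apply/eqP/eqP => [/(congr1 val) [] //|->]; apply: val_inj.
apply/allpairsPdep/eqP => [[r [c' [hr hc' ->]]]|hc].
  move: hr hc'; rewrite mem_iota IH => hr /eqP /= ->; lia.
case/tupleP: c hc => x c' hc; exists (sumn c'), c'; split.
- by rewrite mem_iota -hc /=; lia.
- by rewrite IH.
- by apply: val_inj; rewrite /= -hc /= addnK.
Qed.

Lemma compositions_uniq f N : uniq (compositions f N).
Proof.
elim: f N => [|f IH] N //.
have -> : compositions f.+1 N
  = flatten [seq [seq cons_tuple (N - r)%N c | c <- compositions f r] | r <- iota 0 N.+1] by [].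
apply: (@uniq_flatten_graded _ _ _ _ (fun c : f.+2.-tuple nat => sumn (behead c))) => //.
- exact: iota_uniq.
- by move=> r; rewrite map_inj_uniq // => c c' /(congr1 val) [] /val_inj.
- by move=> r _ /mapP[c hc ->] /=; apply/eqP; rewrite -mem_compositions.
Qed.

(** Grouped by k = m + 2n, the index of [cap], so that the sum over pairs becomes a [convqf]. *)
Definition index_pairs (L : nat) : seq (nat * nat) :=
  [seq ((k - n.*2)%N, n) | k <- iota 0 L.+1, n <- [seq n <- iota 0 k.+1 | (n.*2 <= k)%N]].

Lemma mem_index_pairs L m n : ((m, n) \in index_pairs L) = (m + n.*2 <= L)%N.
Proof.
apply/allpairsPdep/idP => [[k [n' [hk]]]|h].
  by rewrite mem_filter !mem_iota in hk *; move=> h [-> ->]; lia.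
exists (m + n.*2)%N, n; split; last by rewrite addnK.
  by rewrite mem_iota; lia.
by rewrite mem_filter mem_iota; lia.
Qed.

Lemma index_pairs_uniq L : uniq (index_pairs L).
Proof.
apply: (@uniq_flatten_graded _ _ _ _ (fun mn => (mn.1 + mn.2.*2)%N)).
- exact: iota_uniq.
- by move=> k; rewrite map_inj_uniq ?filter_uniq ?iota_uniq // => n n' [].
- move=> k t /mapP[n hn ->] /=; move: hn; rewrite mem_filter => /andP[h _].
  by rewrite subnK.
Qed.

Lemma size_index_pairs L : (size (index_pairs L) <= 4 ^ L)%N.
Proof.
apply: (@leq_trans (L.+1 * L.+1)%N); last first.
  by rewrite -[4%N]/(2 * 2)%N expnMn leq_mul // ltn_expl.
have <- : size [seq (m, n) | m <- iota 0 L.+1, n <- iota 0 L.+1] = (L.+1 * L.+1)%N.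
  by rewrite size_allpairs !size_iota.
apply: uniq_leq_size; first exact: index_pairs_uniq.
move=> [m n]; rewrite mem_index_pairs => h.
by apply/allpairsP; exists (m, n); rewrite !mem_iota /=; split => //; lia.
Qed.

Section Summand.
Variables (R : realType) (q : R[i]).
Hypothesis q1 : normc q < 1.
Let p := q ^+ 3.

Let q_free : forall k, 1 - q ^+ k.+1 != 0. Proof. exact: free_of_normc_lt1. Qed.
Let p1 : normc p < 1. Proof. by rewrite normc_exp exprn_ilt1 ?normc_ge0. Qed.
Let qfq_neq0 n : qfact q n != 0. Proof. exact: qfact_neq0. Qed.
Let qfp_neq0 n : qfact p n != 0.
Proof. by apply: qfact_neq0; exact: free_of_normc_lt1. Qed.

(** The last entry contributes no q-factorial: everything else depending on n_f is put into
    [beta]. *)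
Fixpoint chain_weight (s : seq nat) : R[i] :=
  match s with
  | [::] => 1
  | n :: s' => p ^+ (sumn s ^ 2) * chain_weight s' / (if s' is [::] then 1 else qfact p n)
  end.

(** The subtraction never truncates, since m <= m^2 and n <= n^2. *)
Definition pair_exp (m n : nat) : nat :=
  (2 * m ^ 2 + 6 * m * n + 6 * n ^ 2 - (2 * m + 3 * n))%N.

Definition pair_term (L : nat) (mn : nat * nat) : R[i] :=
  q ^+ pair_exp mn.1 mn.2
  / (qfact q mn.1 * qfact p mn.2 * qfact p (L - (mn.1 + mn.2.*2))).

Definition beta_prefactor (L : nat) : R[i] :=
  qfact p L * (1 + p ^+ L) / qfact p L.*2.

Definition beta (L : nat) : R[i] :=
  beta_prefactor L * \sum_(mn <- index_pairs L) pair_term L mn.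

Lemma sum_nth_sumn (s : seq nat) :
  (\sum_(1 <= j < (size s).+1) nth 0 s j.-1 = sumn s)%N.
Proof. by rewrite big_add1 /= sumnE [RHS](big_nth 0%N). Qed.

Lemma chain_weightE (s : seq nat) :
  chain_weight s
  = p ^+ (\sum_(1 <= i < (size s).+1)
            (\sum_(i <= j < (size s).+1) nth 0 s j.-1) ^ 2)%N
    / \prod_(1 <= i < size s) qfact p (nth 0%N s i.-1).
Proof.
elim: s => [|n s IH]; first by rewrite /= !big_geq // expr0 divr1.
rewrite /= -[n :: s]/([:: n] ++ s) big_ltn // (sum_nth_sumn (n :: s)) exprD.
have -> : (\sum_(2 <= i < (size s).+2)
    (\sum_(i <= j < (size s).+2) nth 0 ([:: n] ++ s) j.-1) ^ 2
  = \sum_(1 <= i < (size s).+1)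
            (\sum_(i <= j < (size s).+1) nth 0 s j.-1) ^ 2)%N.
  rewrite big_add1 /= !big_nat; apply: eq_bigr => i /andP[i1 _]; congr (_ ^ 2)%N.
  rewrite big_add1 /= !big_nat; apply: eq_bigr => j /andP[hj _].
  by case: j hj => //=; lia.
rewrite {}IH; case: s => [|x s] /=; first by rewrite !big_geq // !divr1.
have -> : \prod_(1 <= i < (size s).+2) qfact p (nth 0%N ([:: n] ++ x :: s) i.-1)
   = qfact p n * \prod_(1 <= i < (size s).+1) qfact p (nth 0%N (x :: s) i.-1).
  rewrite big_ltn // big_add1 /=; congr (_ * _); rewrite !big_nat.
  by apply: eq_bigr => -[].
by rewrite invfM; ring.
Qed.

Lemma q_exponentE f (ns : f.-tuple nat) m n :
  q_exponent m n ns
  = Posz (pair_exp m n + 3 * \sum_(1 <= i < f.+1) tail_sum ns i ^ 2)%N.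
Proof.
rewrite /q_exponent.
have -> : \sum_(1 <= i < f.+1) (tail_sum ns i)%:Z ^+ 2
   = Posz (\sum_(1 <= i < f.+1) tail_sum ns i ^ 2)%N.
  by rewrite (big_morph Posz PoszD (erefl _)); apply: eq_bigr => i _; rewrite -rmorphXn.
have h : (2 * m + 3 * n <= 2 * m ^ 2 + 6 * m * n + 6 * n ^ 2)%N by nia.
rewrite /pair_exp; set S := (\sum_(_ <= _ < _) _)%N.
rewrite PoszD -subzn //; lia.
Qed.

Lemma summandE f (ns : f.+1.-tuple nat) m n : (m + n.*2 <= last 0%N ns)%N ->
  summand q (m, n, ns)
  = chain_weight ns * (beta_prefactor (last 0%N ns) * pair_term (last 0%N ns) (m, n)).
Proof.
move=> h; rewrite /summand.
have eL : entry ns f.+1 = last 0%N ns by rewrite /entry -nth_last size_tuple.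
rewrite eL q_exponentE chain_weightE size_tuple /beta_prefactor /pair_term /=.
set L := last 0%N ns in h *.
have -> : (L%:Z - 2 * n%:Z - m%:Z) = Posz (L - (m + n.*2)) by lia.
rewrite /= -exprnP exprD !exprM -/p mul2n.
rewrite -[qpoch p p]/(qfact p) -[qpoch q q]/(qfact q).
set S := (\sum_(1 <= i < f.+2) tail_sum ns i ^ 2)%N.
set D := \prod_(1 <= i < f.+1) qfact p (entry ns i).
have D0 : D != 0 by rewrite prodf_seq_neq0; apply/allP => i _; exact: qfp_neq0.
have h1 := qfq_neq0 m; have h2 := qfp_neq0 n; have h3 := qfp_neq0 (L - (m + n.*2)).
have h4 := qfp_neq0 L.*2.
by field; rewrite D0 h1 h2 h3 h4.
Qed.

Lemma summand_eq0 f (ns : f.+1.-tuple nat) m n : (last 0%N ns < m + n.*2)%N ->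
  summand q (m, n, ns) = 0.
Proof.
move=> h; rewrite /summand.
have eL : entry ns f.+1 = last 0%N ns by rewrite /entry -nth_last size_tuple.
rewrite eL; set L := last 0%N ns in h *.
have -> : (L%:Z - 2 * n%:Z - m%:Z) = Negz ((m + n.*2) - L).-1 by lia.
by rewrite /= mulr0 mul0r.
Qed.

Definition graded_index f N : seq (nat * nat * f.+1.-tuple nat) :=
  [seq (mn, ns) | ns : f.+1.-tuple nat <- compositions f N,
                  mn : nat * nat <- index_pairs (last 0%N ns)].

Definition graded_rank f (t : nat * nat * f.+1.-tuple nat) : nat := sumn t.2.

Lemma graded_index_uniq f N : uniq (graded_index f N).
Proof.
apply: (@uniq_flatten_graded _ _ _ _ (fun t => t.2)).
- exact: compositions_uniq.
- by move=> ns; rewrite map_inj_uniq ?index_pairs_uniq // => mn mn' [].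
- by move=> ns _ /mapP[mn _ ->].
Qed.

Lemma graded_index_rank f N t : t \in graded_index f N -> graded_rank t = N.
Proof.
move=> /allpairsPdep[ns [mn [hns _ ->]]]; apply/eqP.
by rewrite -mem_compositions.
Qed.

Lemma graded_index_supp f (t : nat * nat * f.+1.-tuple nat) :
  summand q t != 0 -> t \in graded_index f (graded_rank t).
Proof.
case: t => [[m n] ns] h; apply/allpairsPdep; exists ns, (m, n); split => //.
  by rewrite mem_compositions.
rewrite mem_index_pairs leqNgt; apply: contra h => h; apply/eqP.
exact: summand_eq0.
Qed.

Definition chain_sum (g : nat -> R[i]) f N : R[i] :=
  \sum_(ns <- compositions f N) chain_weight ns * g (last 0%N ns).

Lemma sum_graded_index f N :
  \sum_(t <- graded_index f N) summand q t = chain_sum beta f N.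
Proof.
rewrite big_allpairs_dep; apply: eq_bigr => ns _.
rewrite /beta mulrA mulr_sumr big_seq [RHS]big_seq; apply: eq_bigr => -[m n].
by rewrite mem_index_pairs => h; rewrite summandE // mulrA.
Qed.

Lemma chain_sum0 g N : chain_sum g 0 N = p ^+ (N ^ 2) * g N.
Proof. by rewrite /chain_sum big_seq1 /= addn0 divr1 mulr1. Qed.

Lemma chain_weight_cons n f (c : f.+1.-tuple nat) :
  chain_weight (n :: c) = p ^+ ((n + sumn c) ^ 2) * chain_weight c / qfact p n.
Proof. by case/tupleP: c => x c. Qed.

Lemma chain_sumS g f N :
  chain_sum g f.+1 N
  = p ^+ (N ^ 2) * \sum_(r < N.+1) chain_sum g f r / qfact p (N - r).
Proof.
rewrite /chain_sum big_allpairs_dep mulr_sumr.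
rewrite -[iota 0 N.+1]/(index_iota 0 N.+1) ?subn0 big_mkord; apply: eq_bigr => r _.
rewrite mulr_suml mulr_sumr big_seq [RHS]big_seq; apply: eq_bigr => c.
rewrite mem_compositions => /eqP hc.
rewrite [tval _]/= chain_weight_cons hc subnK; last by rewrite -ltnS.
have -> : last 0%N ((N - r)%N :: c) = last 0%N c by case/tupleP: c {hc} => x c.
by rewrite -!mulrA; congr (_ * (_ * _)); rewrite mulrC.
Qed.

Lemma chain_sum_bailey (al g : nat -> R[i]) f N :
  (forall L, g L = \sum_(j < L.+1) al j / (qfact p (L - j) * qfact p (L + j))) ->
  chain_sum g f N = p ^+ (N ^ 2)
    * \sum_(j < N.+1) p ^+ (f * j ^ 2) * al j / (qfact p (N - j) * qfact p (N + j)).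
Proof.
move=> hg; elim: f N => [|f IH] N.
  by rewrite chain_sum0 hg; under [in RHS]eq_bigr do rewrite mul0n expr0 mul1r.
rewrite chain_sumS; congr (_ * _).
under eq_bigr do rewrite IH.
have := @bailey_step R[i] p (free_of_normc_lt1 p1)
  (fun j => p ^+ (f * j ^ 2) * al j) _ (fun L => erefl) N => /= ->.
by apply: eq_bigr => j _; rewrite mulrA -exprD -mulSn.
Qed.

Lemma pair_term_bound : exists2 K : R, 0 <= K &
  forall L mn, normc (beta_prefactor L * pair_term L mn) <= K.
Proof.
have [c c0 hc] := inv_qfact_bound p1; have [cq cq0 hcq] := inv_qfact_bound q1.
have [b b0 hb] := qfact_bound p1.
exists (b * 2 * c * (1 * (cq * c * c))) => [|L mn].
  by rewrite ?mulr_ge0 ?ltW.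
rewrite /beta_prefactor /pair_term !invfM !normcM.
have X_le1 (x : R[i]) n : normc x < 1 -> normc (x ^+ n) <= 1.
  by move=> x1; rewrite normc_exp exprn_ile1 ?normc_ge0 // ltW.
have h2 : normc (1 + p ^+ L) <= 2.
  apply: le_trans (normc_triangle _ _) _; rewrite normc1.
  by have := X_le1 p L p1; lra.
repeat (apply: ler_pM; rewrite ?mulr_ge0 ?normc_ge0 //).
exact: X_le1.
Qed.

(** The weight 4^(n_f) allows for the number of pairs (m, n), by [size_index_pairs]. Each step costs
    a factor N + 1 <= 2^N for the choice of r; of all the Gaussian factors only that of N_1 is kept,
    and by [gaussian_le_geometric] it suffices. *)
Lemma chain_weight_sum_bound (c : R) : 0 <= c ->
  (forall n, normc (qfact p n)^-1 <= c) -> forall f N,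
  \sum_(ns <- compositions f N) normc (chain_weight ns) * 4 ^+ last 0%N ns
  <= c ^+ f * (4 * 2 ^+ f) ^+ N * normc p ^+ (N ^ 2).
Proof.
move=> c0 hc; elim=> [|f IH] N.
  rewrite big_seq1 /= addn0 divr1 mulr1 normc_exp expr0 mul1r mulr1.
  by rewrite mulrC.
set d := 4 * 2 ^+ f in IH *; have d1 : 1 <= d :> R.
  by have : 1 <= 2 ^+ f :> R by [apply: exprn_ege1; lra]; rewrite /d; lra.
have d0 : 0 <= d by lra.
have r0 : 0 <= normc p by exact: normc_ge0.
have cf0 : 0 <= c ^+ f by exact: exprn_ge0.
rewrite big_allpairs_dep.
rewrite -[iota 0 N.+1]/(index_iota 0 N.+1) ?subn0 big_mkord.
apply: (@le_trans _ _ (\sum_(r < N.+1) normc p ^+ (N ^ 2) * (c * (c ^+ f * d ^+ N)))).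
  apply: ler_sum => r _; have hr : (r <= N)%N by rewrite -ltnS.
  apply: (@le_trans _ _ (normc p ^+ (N ^ 2) * (c *
      \sum_(ns <- compositions f r) normc (chain_weight ns) * 4 ^+ last 0%N ns))).
    rewrite !mulr_sumr big_seq [leRHS]big_seq; apply: ler_sum => ns.
    rewrite mem_compositions => /eqP hns.
    rewrite [tval _]/= chain_weight_cons hns subnK //.
    have -> : last 0%N ((N - r)%N :: ns) = last 0%N ns by case/tupleP: ns {hns} => x ns.
    rewrite normcM (normcM (p ^+ (N ^ 2))) (normc_exp p (N ^ 2)) -!mulrA.
    apply: ler_wpM2l; first exact: exprn_ge0.
    rewrite mulrCA; apply: ler_wpM2r; last exact: hc.
    by rewrite mulr_ge0 ?normc_ge0 // exprn_ge0.
  apply: ler_wpM2l; first exact: exprn_ge0.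
  apply: ler_wpM2l => //; apply: le_trans (IH r) _.
  rewrite -mulrA; apply: ler_wpM2l => //.
  rewrite -[leRHS]mulr1; apply: ler_pM; rewrite ?exprn_ge0 //.
    exact: ler_weXn2l.
  by rewrite exprn_ile1 // ltW.
rewrite sumr_const card_ord -[leLHS]mulr_natl.
have hN : N.+1%:R <= 2 ^+ N :> R by rewrite -natrX ler_nat ltn_expl.
have -> : c ^+ f.+1 * (4 * 2 ^+ f.+1) ^+ N * normc p ^+ (N ^ 2)
   = 2 ^+ N * (normc p ^+ (N ^ 2) * (c * (c ^+ f * d ^+ N))).
  rewrite (exprS c) (exprS 2) mulrCA -/d exprMn; ring.
apply: ler_wpM2r => //.
by rewrite !mulr_ge0 ?exprn_ge0.
Qed.

Lemma graded_index_bound f : exists c : R, forall N,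
  \sum_(t <- graded_index f N) normc (summand q t) <= c * 2^-1 ^+ N.
Proof.
have [K K0 hK] := pair_term_bound.
have [c c0 hc] := inv_qfact_bound p1.
have D0 : 0 <= 4 * 2 ^+ f :> R by rewrite mulr_ge0 ?exprn_ge0.
have r01 : 0 <= normc p < 1 by rewrite normc_ge0 p1.
have [g hg] := gaussian_le_geometric D0 r01.
exists (K * (c ^+ f * g)) => N.
rewrite big_allpairs_dep.
apply: (@le_trans _ _ (K * \sum_(ns <- compositions f N)
    normc (chain_weight ns) * 4 ^+ last 0%N ns)).
  rewrite mulr_sumr; apply: ler_sum => ns _.
  apply: (@le_trans _ _ (\sum_(mn <- index_pairs (last 0%N ns)) normc (chain_weight ns) * K)).
    rewrite big_seq [leRHS]big_seq; apply: ler_sum => -[m n].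
    rewrite mem_index_pairs => h; rewrite summandE // normcM.
    by apply: ler_wpM2l; [exact: normc_ge0 | exact: hK].
  rewrite big_const_seq count_predT iter_addr_0 -[leLHS]mulr_natr mulrAC mulrC.
  apply: ler_wpM2l => //; apply: ler_wpM2l; first exact: normc_ge0.
  by rewrite -natrX ler_nat size_index_pairs.
rewrite -!mulrA; apply: ler_wpM2l => //.
apply: le_trans (chain_weight_sum_bound (ltW c0) hc f N) _.
by rewrite -mulrA; apply: ler_wpM2l; [rewrite exprn_ge0 // ltW | exact: hg].
Qed.

Lemma chain_sum_beta_bounded f : geometric_bounded (chain_sum beta f).
Proof.
have [c hc] := graded_index_bound f; exists c, 2^-1; split; first by lra.
by move=> N; rewrite -sum_graded_index; apply: le_trans (normc_sum _ _ _) (hc N).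
Qed.

Lemma summand_sum_cvg f (l : R[i]) :
  ((fun L => \sum_(N < L.+1) chain_sum beta f N) : nat -> R[i]^o) @ \oo --> (l : R[i]^o) ->
  partial_sum (@summand R f.+1 q) @ totally --> (l : R[i]^o).
Proof.
move=> h; have [c hc] := graded_index_bound f.
apply: (@graded_sum_cvg R _ (@summand R f.+1 q) (graded_index f) (@graded_rank f)
  (@graded_index_uniq f) (@graded_index_rank f) (@graded_index_supp f) c 2^-1) => //.
  by lra.
by under eq_fun do under eq_bigr do rewrite sum_graded_index.
Qed.

Lemma sum_pair_term L : q != 0 ->
  \sum_(mn <- index_pairs L) pair_term L mn = convqf p (cap_phi q) L.
Proof.
move=> q0; rewrite big_allpairs_dep.
rewrite -[iota 0 L.+1]/(index_iota 0 L.+1) ?subn0 big_mkord; apply: eq_bigr => k _.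
rewrite /cap_phi /cap mulr_sumr mulr_suml big_filter.
rewrite -[iota 0 k.+1]/(index_iota 0 k.+1) ?subn0 big_mkord big_mkcond.
apply: eq_bigr => n _; rewrite /cap_term; case: ifP => h; last by rewrite mulr0 mul0r.
rewrite /pair_term /= subnK //; set m := (k - n.*2)%N.
(* With k = m + 2n, 2m + 3n = 2k - n. *)
have -> : q ^+ pair_exp m n
   = q ^+ (2 * m ^ 2 + 6 * m * n + 6 * n ^ 2) * q ^+ n / (q ^+ k) ^+ 2.
  have qk : (q ^+ k) ^+ 2 != 0 by rewrite !expf_neq0.
  apply: (canRL (mulfK qk)); rewrite -exprM -!exprD; congr (_ ^+ _).
  have : (2 * m + 3 * n <= 2 * m ^ 2 + 6 * m * n + 6 * n ^ 2)%N by clear; nia.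
  by rewrite /pair_exp; have : k = (m + n.*2)%N :> nat by [rewrite /m subnK]; lia.
have h1 := qfq_neq0 m; have h2 := qfp_neq0 n; have h3 := qfp_neq0 (L - k).
have h4 : q ^+ k != 0 by rewrite expf_neq0.
by field; rewrite h1 h2 h3 h4.
Qed.

(** For i >= 1 both exponents e i^2 - d i and e i^2 + d i are at least i, because e - d >= 1. *)
Lemma theta_term_le e d j : (3 <= e)%N -> (d <= 2)%N -> q != 0 ->
  normc ((q ^+ e) ^+ (j ^ 2) * sym_pow (q ^- d) j) <= 2 * normc q ^+ j.
Proof.
move=> e3 d2 q0; case: j => [|j].
  by rewrite /sym_pow mulr1 -[(0 ^ 2)%N]/0%N !expr0 normc1; lra.
rewrite /sym_pow.
set i := j.+1.
have r0 := normc_ge0 q.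
have up k : (i <= k)%N -> normc (q ^+ k) <= normc q ^+ i.
  by move=> h; rewrite normc_exp; apply: ler_wiXn2l => //; exact: ltW.
have -> : (q ^+ e) ^+ (i ^ 2) * ((q ^- d) ^+ i + (q ^- d) ^- i)
   = q ^+ (e * i ^ 2 - d * i) + q ^+ (e * i ^ 2 + d * i).
  rewrite mulrDr -!exprM exprVn invrK -exprM -exprD; congr (_ + _).
  have h : (d * i <= e * i ^ 2)%N by rewrite /i; nia.
  by rewrite -[in LHS](subnK h) exprD mulfK // expf_neq0.
apply: le_trans (normc_triangle _ _) _; rewrite mulr_natl mulr2n.
by apply: lerD; apply: up; rewrite /i; nia.
Qed.

End Summand.

Lemma normc_lt1 (R : realType) (q : R[i]) : `|q| < 1 -> normc q < 1.
Proof. by rewrite normr_normc -[X in _ < X]/((1 : R)%:C%C) ltcR. Qed.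

(** Since 0^0 = 1, the term with all indices zero survives, and its factor 1 + q^(3 n_f) is 2. *)
Lemma chain_sum_beta_q0 (R : realType) f N :
  chain_sum (0 : R[i]) (beta (0 : R[i])) f N = if N is 0 then 2 else 0.
Proof.
have p0 : (0 : R[i]) ^+ 3 = 0 by rewrite expr0n.
case: N => [|N]; last first.
  by case: f => [|f]; rewrite ?chain_sum0 ?chain_sumS p0 expr0n mul0r.
elim: f => [|f IH]; last first.
  by rewrite chain_sumS big_ord1 IH p0 expr0n /= qfact0 mul1r divr1.
rewrite chain_sum0 p0 expr0n mul1r /beta /beta_prefactor /index_pairs /=.
rewrite big_seq1 /pair_term /= !qfact0 -[pair_exp 0 0]/0%N !expr0 !mulr1 !divr1.
by ring.
Qed.

Lemma qpoch_infty_q0 (R : realType) (p : R[i]) : qpoch_infty 0 p = 1.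
Proof.
rewrite /qpoch_infty.
have -> : (fun n => qpoch (0 : R[i]) p n : R[i]^o) = (fun=> 1).
  by apply/funext => n; rewrite /qpoch big1 // => k _; rewrite mul0r subr0.
by apply: lim_cst.
Qed.

Lemma cvg_to_eq (R : realType) (u : nat -> R[i]^o) (l l' : R[i]^o) :
  l = l' -> u @ \oo --> l -> u @ \oo --> l'.
Proof. by move=> ->. Qed.

Section MainLimit.
Variables (R : realType) (q : R[i]).
Hypotheses (q1 : normc q < 1) (q0 : q != 0).
Let p := q ^+ 3.

Lemma chain_sum_beta_conv f L :
  let h := q ^+ (3 * (f + 2)) in
  \sum_(N < L.+1) chain_sum q (beta q) f N / qfact p (L - N)
  = \sum_(j < L.+1) (h ^+ (j ^ 2) * sym_pow (q ^- 2) j + h ^+ (j ^ 2) * sym_pow (q ^- 1) j)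
      / (qfact p (L - j) * qfact p (L + j)).
Proof.
have p1 : normc p < 1 by rewrite normc_exp exprn_ilt1 ?normc_ge0.
have hb L' : beta q L' = \sum_(j < L'.+1)
    p ^+ (j ^ 2) * (sym_pow q^-1 j + sym_pow (q ^- 2) j)
      / (qfact p (L' - j) * qfact p (L' + j)).
  by rewrite -(cap_bailey_pair q0 (free_of_normc_lt1 q1)) /beta sum_pair_term.
move=> h.
have -> : \sum_(N < L.+1) chain_sum q (beta q) f N / qfact p (L - N)
   = \sum_(j < L.+1) p ^+ (f.+1 * j ^ 2)
       * (p ^+ (j ^ 2) * (sym_pow q^-1 j + sym_pow (q ^- 2) j))
       / (qfact p (L - j) * qfact p (L + j)).
  (* Up to p^(L^2) the convolution is one further Bailey step, hence p^((f+1) j^2); with the p^(j^2)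
     already in alpha_j this makes h^(j^2). *)
  have pL : p ^+ (L ^ 2) != 0 by rewrite !expf_neq0.
  apply: (mulfI pL); rewrite -chain_sumS.
  by rewrite (@chain_sum_bailey _ q q1
    (fun j => p ^+ (j ^ 2) * (sym_pow q^-1 j + sym_pow (q ^- 2) j)) (beta q) f.+1 L hb).
apply: eq_bigr => j _; congr (_ / _); rewrite expr1 -mulrDr addrC mulrA -exprD.
congr (_ * _); rewrite /h /p -!exprM; congr (_ ^+ _).
by rewrite mulSn; lia.
Qed.

End MainLimit.

Theorem theorem20 (R : realType) (f : nat) (f_gt0 : (0 < f)%N)
    (q : R[i]) (q_lt1 : `|q| < 1) :
  let Q := q ^+ (6 * (f + 1)) in
  partial_sum (@summand R f q) @ totally -->
    qpoch_infty Q Q / qpoch_infty (q ^+ 3) (q ^+ 3)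
    * (qpoch_infty (- q ^+ (3 * f + 1)) Q * qpoch_infty (- q ^+ (3 * f + 5)) Q
       + qpoch_infty (- q ^+ (3 * f + 2)) Q
         * qpoch_infty (- q ^+ (3 * f + 4)) Q).
Proof.
case: f f_gt0 => // f _ Q; have q1 := normc_lt1 q_lt1.
apply: summand_sum_cvg => //.
have [q0|q0] := eqVneq q 0.
  have z n : (0 : R[i]) ^+ n.+1 = 0 by rewrite expr0n.
  rewrite /Q q0 !addnS !mulnS !addSn !z oppr0 !qpoch_infty_q0.
  have -> : (fun L => \sum_(N < L.+1) chain_sum (0 : R[i]) (beta (0 : R[i])) f N) = (fun=> 2).
    apply/funext => L; rewrite big_ord_recl chain_sum_beta_q0 big1 ?addr0 //.
    by move=> i _; rewrite chain_sum_beta_q0.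
  have -> : 1 / 1 * (1 * 1 + 1 * 1) = 2 :> R[i] by rewrite divr1; ring.
  exact: cvg_cst.
have p1 : normc (q ^+ 3) < 1 by rewrite normc_exp exprn_ilt1 ?normc_ge0.
set h := q ^+ (3 * (f + 2)).
have h0 : h != 0 by rewrite expf_neq0.
have h1 : normc h < 1.
  by rewrite normc_exp exprn_ilt1 ?normc_ge0 // addnS mulnS.
have e3 : (3 <= 3 * (f + 2))%N by lia.
have q01 : 0 <= normc q < 1 by rewrite normc_ge0.
have b d : (d <= 2)%N -> forall j, normc (h ^+ (j ^ 2) * sym_pow (q ^- d) j)
    <= 2 * normc q ^+ j by move=> d2 j; exact: theta_term_le.
have bd d : (d <= 2)%N -> geometric_bounded (fun j => h ^+ (j ^ 2) * sym_pow (q ^- d) j).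
  by move=> d2; exists 2, (normc q); split => // j; exact: b.
have zV d : q ^- d != 0 by rewrite invr_eq0 expf_neq0.
(* After the shift of f, h = q^(3(f+2)) is the square root of Q. Multiplying it by z and by 1/z
   changes the exponent 3(f+2) by 1 for z = q^(-1), and by 2 for z = q^(-2): these are the four
   exponents of the right-hand side. *)
have t1 := jacobi_triple_product h0 (zV 1%N) h1 (bd _ (isT : (1 <= 2)%N)).
have t2 := jacobi_triple_product h0 (zV 2%N) h1 (bd _ (isT : (2 <= 2)%N)).
have b12 : geometric_bounded (fun j => h ^+ (j ^ 2) * sym_pow (q ^- 2) j
    + h ^+ (j ^ 2) * sym_pow (q ^- 1) j).
  exists (2 + 2), (normc q); split => // j.
  by apply: le_trans (normc_triangle _ _) _; rewrite mulrDl; apply: lerD; exact: b.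
have t12 : ((fun L => \sum_(j < L.+1) (h ^+ (j ^ 2) * sym_pow (q ^- 2) j
    + h ^+ (j ^ 2) * sym_pow (q ^- 1) j)) : nat -> R[i]^o) @ \oo -->
  (qpoch_infty (h ^+ 2) (h ^+ 2)
   * (qpoch_infty (- (q ^- 2 * h)) (h ^+ 2) * qpoch_infty (- ((q ^- 2)^-1 * h)) (h ^+ 2))
  + qpoch_infty (h ^+ 2) (h ^+ 2)
   * (qpoch_infty (- (q ^- 1 * h)) (h ^+ 2) * qpoch_infty (- ((q ^- 1)^-1 * h)) (h ^+ 2))
   : R[i]^o).
  by under eq_fun do rewrite big_split /=; exact: cvgD t2 t1.
have l := bailey_limit p1 (chain_sum_beta_bounded q1 f) b12
  (chain_sum_beta_conv q1 q0 f) t12.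
have hQ : h ^+ 2 = Q by rewrite /h /Q -exprM; congr (_ ^+ _); lia.
have qh d : (d <= 2)%N -> q ^- d * h = q ^+ (3 * (f + 2) - d).
  move=> d2; have hd : (d <= 3 * (f + 2))%N by lia.
  by rewrite /h -[in LHS](subnK hd) exprD mulrC mulfK // expf_neq0.
have qh' d : (q ^- d)^-1 * h = q ^+ (d + 3 * (f + 2)) by rewrite invrK -exprD.
have i1 : (3 * f.+1 + 1 = 3 * (f + 2) - 2)%N by lia.
have i2 : (3 * f.+1 + 5 = 2 + 3 * (f + 2))%N by lia.
have i3 : (3 * f.+1 + 2 = 3 * (f + 2) - 1)%N by lia.
have i4 : (3 * f.+1 + 4 = 1 + 3 * (f + 2))%N by lia.
apply: (cvg_to_eq _ l).
rewrite hQ (qh 2%N isT) (qh 1%N isT) (qh' 2%N) (qh' 1%N) i1 i2 i3 i4.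
by rewrite -mulrDr mulrAC.
Qed.
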